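(* Let $X\in\mathbb{R}^{n\times n}$ be a rank $r$ matrix and let $T$ be the tangent space of the rank $r$ matrix manifold at $X$. Let $\Omega$ be a collection of $m\ge 1$ indices in $\{1,\dots,n\}^2$ (with multiplicity), $p=m/n^2$, and let $X_0$ be a rank $r$ matrix. Suppose that for some $\beta>1$ and some constant $\varepsilon_0$ with $0<\varepsilon_0<1/4$ and $$\nu_g=\frac{18\varepsilon_0}{1-4\varepsilon_0}<1,$$ the following hold: $$\|\mathcal{P}_\Omega\|\le \tfrac{8}{3}\beta\log(n),\qquad \|\mathcal{P}_T-p^{-1}\mathcal{P}_T\mathcal{P}_\Omega\mathcal{P}_T\|\le\varepsilon_0,\qquad \frac{\|X_0-X\|_F}{\sigma_{\min}(X)}\le\frac{3p^{1/2}\varepsilon_0}{16\beta\log(n)(1+\varepsilon_0)}.$$ Then the iterates $X_l$ generated by the Riemannian gradient descent algorithm (RGrad) started from $X_0$ satisfy, for all $l\ge 0$, $$\|X_l-X\|_F\le\nu_g^{\,l}\,\|X_0-X\|_F.$$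
   Context: Here $n\ge 2$ and $1\le r\le n$. $\|\cdot\|_F$ is the Frobenius norm; $\sigma_{\min}(X)$ is the smallest nonzero singular value of $X$; $\langle\cdot,\cdot\rangle$ is the Frobenius inner product; the norm $\|\mathcal{A}\|$ of a linear operator $\mathcal{A}$ on $\mathbb{R}^{n\times n}$ is its operator norm with respect to the Frobenius norm. Sampling operator: $\mathcal{P}_\Omega(Z)$ is the entrywise product of $Z$ with $\sum_{(i,j)\in\Omega}e_ie_j^*$, where repeated indices in $\Omega$ are counted with multiplicity. Tangent space: for a rank $r$ matrix $Y$ with reduced SVD $Y=U_Y\Sigma_YV_Y^*$, the tangent space of the rank $r$ matrix manifold at $Y$ is $\{U_YZ_1^*+Z_2V_Y^*: Z_1,Z_2\in\mathbb{R}^{n\times r}\}$, and $\mathcal{P}_{T}$ denotes the orthogonal projection (Frobenius inner product) onto a tangent space $T$. Hard thresholding: $\mathcal{H}_r(Z)$ keeps the $r$ largest singular values in an SVD of $Z$ and sets the others to zero (a best rank $r$ approximation of $Z$; ties are broken arbitrarily). RGrad: given $X_0$, for $l=0,1,\dots$ let $T_l$ be the tangent space at $X_l$ and set $G_l=\mathcal{P}_\Omega(X-X_l)$, $\alpha_l=\dfrac{\|\mathcal{P}_{T_l}(G_l)\|_F^2}{\langle\mathcal{P}_{T_l}(G_l),\mathcal{P}_\Omega\mathcal{P}_{T_l}(G_l)\rangle}$, $W_l=X_l+\alpha_l\mathcal{P}_{T_l}(G_l)$, $X_{l+1}=\mathcal{H}_r(W_l)$. If $\mathcal{P}_{T_l}(G_l)=0$,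 then $X_{l+1}=X_l$. *)

(* Defs.v *)
From mathcomp Require Import all_boot all_order all_algebra.
From mathcomp Require Import boolp classical_sets reals topology exp.

Set Implicit Arguments.
Unset Strict Implicit.
Unset Printing Implicit Defensive.

Import Order.TTheory GRing.Theory Num.Theory.
Local Open Scope classical_set_scope.
Local Open Scope ring_scope.

Section Frobenius.
Context {R : realType} {n : nat}.
Implicit Types (A B Z : 'M[R]_n) (F : 'M[R]_n -> 'M[R]_n) (T : set 'M[R]_n).

Definition fdot A B : R := \sum_(i < n) \sum_(j < n) A i j * B i j.

Definition fnorm A : R := Num.sqrt (fdot A A).

(* For linear F the set is nonempty and bounded, so the supremum is genuine. *)
Definition opnorm F : R := sup [set fnorm (F Z) | Z in [set Z | fnorm Z <= 1]].

(* When T is a linear subspace, such a W exists and is unique; the default 0 is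
   used only if there is none. *)
Definition orth_proj T Z : 'M[R]_n :=
  xget 0 [set W | T W /\ forall V, T V -> fdot (Z - W) V = 0].

End Frobenius.

Section SVD.
Context {R : realType} {n : nat}.
Implicit Types (Y Z W : 'M[R]_n).

(* k = n with nonnegative s: full SVD; k = rank with positive s: reduced SVD. *)
Definition is_svd_factorization (k : nat) Y
    (U : 'M[R]_(n, k)) (s : 'rV[R]_k) (V : 'M[R]_(n, k)) : Prop :=
  [/\ U^T *m U = 1%:M,
      V^T *m V = 1%:M,
      forall i j : 'I_k, (i <= j)%N -> s 0 j <= s 0 i &
      Y = U *m diag_mx s *m V^T].

Definition is_svd Y (U : 'M[R]_n) (s : 'rV[R]_n) (V : 'M[R]_n) : Prop :=
  is_svd_factorization Y U s V /\ forall i, 0 <= s 0 i.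

Definition is_reduced_svd (r : nat) Y
    (U : 'M[R]_(n, r)) (s : 'rV[R]_r) (V : 'M[R]_(n, r)) : Prop :=
  is_svd_factorization Y U s V /\ forall i, 0 < s 0 i.

Definition singular_value Y (x : R) : Prop :=
  exists (U : 'M[R]_n) (s : 'rV[R]_n) (V : 'M[R]_n) (i : 'I_n),
    is_svd Y U s V /\ x = s 0 i.

(* The set is finite, and nonempty for Y != 0, so the infimum is a minimum. *)
Definition sigma_min Y : R := inf [set x | singular_value Y x /\ x != 0].

(* The column spans of U and V do not depend on the chosen reduced SVD, so for
   Y of rank r the union over all reduced SVDs is the tangent space obtained
   from any single one. *)
Definition tangent_space (r : nat) Y : set 'M[R]_n :=
  [set Z | exists (U : 'M[R]_(n, r)) (s : 'rV[R]_r) (V : 'M[R]_(n, r)),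
     is_reduced_svd Y U s V /\
     exists Z1 Z2 : 'M[R]_(n, r), Z = U *m Z1^T + Z2 *m V^T].

(* A relation rather than a function: the SVD of Z used for the truncation, and
   with it the resolution of ties, is arbitrary. *)
Definition hard_threshold (r : nat) Z W : Prop :=
  exists (U : 'M[R]_n) (s : 'rV[R]_n) (V : 'M[R]_n),
    is_svd Z U s V /\
    W = U *m diag_mx (\row_i (if (i < r)%N then s 0 i else 0)) *m V^T.

End SVD.

Section RGrad.
Context {R : realType} {n : nat}.
Variables (r : nat) (Omega : seq ('I_n * 'I_n)) (X : 'M[R]_n).
Implicit Types (Y Z : 'M[R]_n).

Definition sampling Z : 'M[R]_n :=
  map2_mx *%R Z (\sum_(w <- Omega) delta_mx w.1 w.2).

Definition tangent_proj Y : 'M[R]_n -> 'M[R]_n :=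
  orth_proj (tangent_space r Y).

Definition rgrad_dir Y : 'M[R]_n := tangent_proj Y (sampling (X - Y)).

Definition rgrad_stepsize Y : R :=
  fnorm (rgrad_dir Y) ^+ 2 / fdot (rgrad_dir Y) (sampling (rgrad_dir Y)).

(* Total by convention: if Y does not have rank r, tangent_space r Y is empty,
   the direction is 0 and the step leaves Y unchanged. *)
Definition rgrad_step Y Y' : Prop :=
  if rgrad_dir Y == 0 then Y' = Y
  else hard_threshold r (Y + rgrad_stepsize Y *: rgrad_dir Y) Y'.

Definition rgrad_iterates (X0 : 'M[R]_n) (Xl : nat -> 'M[R]_n) : Prop :=
  Xl 0%N = X0 /\ forall l, rgrad_step (Xl l) (Xl l.+1).

End RGrad.

(* Main.v *)
(* Every estimate is made in the Frobenius norm.  Writing [P], [Q] for the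
   projectors onto the column and row space of [Y], the tangent projection at
   [Y] is [Z - (1 - P) Z (1 - Q)].  If [Y] has rank [r] and
   [delta = |Y - X| / sigma_min X], then the tangent projections at [Y] and [X]
   differ by at most [2 delta] and [X] is within [delta |Y - X|] of the tangent
   space at [Y].  Hence the restricted isometry property passes from [X] to [Y]
   with constant [4 eps0]; this controls the step size and gives
   [|W - X| <= nu_g / 2 * |Y - X|] for the gradient step [W].  Hard thresholding
   is a best rank [r] approximation, so it at most doubles the error, and the
   new iterate has rank [r] because its distance to [X] is below
   [sigma_min X]. *)
Require Import Defs.
From mathcomp Require Import all_boot all_order all_algebra.
From mathcomp Require Import boolp classical_sets reals topology exp.
From mathcomp Require Import perm zify ring lra.
From mathcomp.real_closed Require Import complex.
Set Implicit Arguments.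
Unset Strict Implicit.
Unset Printing Implicit Defensive.

Import Order.TTheory GRing.Theory Num.Theory.
Local Open Scope ring_scope.

(** * Frobenius inner product *)

(** The obstacle is one of scale. The sampling operator [S] is only known to have norm at most
    [L = 8/3 beta log n], while the isometry defect is divided by [p], so a crude perturbation of
    the tangent projections by [d] costs [d L / p]. One factor [sqrt p] is recovered as follows. The
    sampling weights lie in [[0, L]], hence [|S A|^2 <= L <A, S A>], and for [A] tangent at [X] the
    isometry property bounds the form by [p (1 + eps0) |A|^2]. So [S], preceded by the tangent
    projection, has norm at most [L sqrt p (1 + eps0)]. Since [16 beta log n = 6 L], the hypothesis
    on [X0] says exactly [2 delta L (1 + eps0) <= sqrt p * eps0], which pays for the remaining loss.
    The bounds [1 <= L] and [sqrt p <= L] come from counting multiplicities in [Omega]. In units of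
    [eps0 / (1 - 4 eps0)], the gradient step loses 4 through the step size, 4 through the isometry
    defect at [Y] and 1 through the part of [X] outside the tangent space. Thresholding doubles this
    9 to the 18 of [nu_g]. *)

Lemma sum_cauchy_schwarz (R : realFieldType) (I : finType) (a b : I -> R) :
  (\sum_k a k * b k) ^+ 2 <= (\sum_k a k ^+ 2) * (\sum_k b k ^+ 2).
Proof.
set c := \sum_k a k * b k; set x := \sum_k a k ^+ 2; set y := \sum_k b k ^+ 2.
have y0 : 0 <= y by apply: sumr_ge0 => k _; exact: sqr_ge0.
have E : \sum_k (y * a k - c * b k) ^+ 2 = y * (x * y - c ^+ 2).
  rewrite (eq_bigr (fun k => y ^+ 2 * a k ^+ 2 - (2 * y * c) * (a k * b k)
                             + c ^+ 2 * b k ^+ 2)); last by move=> k _; ring.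
  rewrite !big_split /= sumrN -!mulr_sumr -/x -/y -/c; ring.
have : 0 <= \sum_k (y * a k - c * b k) ^+ 2.
  by apply: sumr_ge0 => k _; exact: sqr_ge0.
rewrite E; have [y1|/negP y1] := boolP (0 < y); first by rewrite pmulr_rge0 // subr_ge0.
move=> _; have {}y0 : y = 0 by apply/eqP; rewrite eq_le y0 andbT leNgt; apply/negP.
suff -> : c = 0 by rewrite expr0n y0 mulr0.
rewrite /c big1 // => k _; have /eqP := y0; rewrite psumr_eq0 => [/allP h|i _]; last exact: sqr_ge0.
by have := h k (mem_index_enum k); rewrite /= sqrf_eq0 => /eqP ->; rewrite mulr0.
Qed.

Section FrobeniusTheory.
Context {R : realType} {n : nat}.
Implicit Types (A B C Z : 'M[R]_n).

Lemma fdotC A B : fdot A B = fdot B A.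
Proof. by apply: eq_bigr => i _; apply: eq_bigr => j _; rewrite mulrC. Qed.

Lemma fdotDl A B C : fdot (A + B) C = fdot A C + fdot B C.
Proof.
rewrite -big_split; apply: eq_bigr => i _; rewrite -big_split.
by apply: eq_bigr => j _; rewrite mxE mulrDl.
Qed.

Lemma fdotZl a A B : fdot (a *: A) B = a * fdot A B.
Proof.
rewrite mulr_sumr; apply: eq_bigr => i _; rewrite mulr_sumr.
by apply: eq_bigr => j _; rewrite mxE mulrA.
Qed.

Lemma fdotNl A B : fdot (- A) B = - fdot A B.
Proof. by rewrite -scaleN1r fdotZl mulN1r. Qed.

Lemma fdotBl A B C : fdot (A - B) C = fdot A C - fdot B C.
Proof. by rewrite fdotDl fdotNl. Qed.

Lemma fdotDr A B C : fdot A (B + C) = fdot A B + fdot A C.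
Proof. by rewrite fdotC fdotDl !(fdotC A). Qed.

Lemma fdotZr a A B : fdot A (a *: B) = a * fdot A B.
Proof. by rewrite fdotC fdotZl fdotC. Qed.

Lemma fdotNr A B : fdot A (- B) = - fdot A B.
Proof. by rewrite fdotC fdotNl fdotC. Qed.

Lemma fdotBr A B C : fdot A (B - C) = fdot A B - fdot A C.
Proof. by rewrite fdotDr fdotNr. Qed.

Lemma fdot0l A : fdot 0 A = 0.
Proof. by rewrite -(scale0r 0) fdotZl mul0r. Qed.

Lemma fdot_tr A B : fdot A B = \tr (A^T *m B).
Proof.
rewrite /mxtrace /fdot exchange_big /=; apply: eq_bigr => j _.
by rewrite mxE; apply: eq_bigr => i _; rewrite mxE.
Qed.

Lemma fdotMl A B C : fdot (A *m B) C = fdot B (A^T *m C).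
Proof. by rewrite !fdot_tr trmx_mul mulmxA. Qed.

Lemma fdotMr A B C : fdot (A *m B) C = fdot A (C *m B^T).
Proof. by rewrite !fdot_tr trmx_mul -mulmxA mxtrace_mulC mulmxA. Qed.

Lemma fdotTT A B : fdot A^T B^T = fdot A B.
Proof.
rewrite /fdot exchange_big /=; apply: eq_bigr => i _.
by apply: eq_bigr => j _; rewrite !mxE.
Qed.

Lemma fdot_ge0 A : 0 <= fdot A A.
Proof. by apply: sumr_ge0 => i _; apply: sumr_ge0 => j _; rewrite -expr2 sqr_ge0. Qed.

Lemma fdot_eq0 A : fdot A A = 0 -> A = 0.
Proof.
move=> /eqP; rewrite psumr_eq0 => [/allP h|i _]; last first.
  by apply: sumr_ge0 => j _; rewrite -expr2 sqr_ge0.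
apply/matrixP => i j; rewrite mxE.
have := h i (mem_index_enum i); rewrite /= psumr_eq0 => [/allP h2|k _]; last first.
  by rewrite -expr2 sqr_ge0.
by have := h2 j (mem_index_enum j); rewrite /= mulf_eq0 orbb => /eqP.
Qed.

Lemma fnorm_ge0 A : 0 <= fnorm A. Proof. exact: sqrtr_ge0. Qed.

Lemma fnorm_sqr A : fnorm A ^+ 2 = fdot A A.
Proof. by rewrite sqr_sqrtr // fdot_ge0. Qed.

Lemma fnorm_eq0 A : fnorm A = 0 -> A = 0.
Proof. by move=> h; apply: fdot_eq0; rewrite -fnorm_sqr h expr0n. Qed.

Lemma fnorm_gt0 A : A != 0 -> 0 < fnorm A.
Proof.
move=> h; rewrite lt_neqAle fnorm_ge0 andbT eq_sym.
by apply: contraNneq h => /fnorm_eq0 ->.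
Qed.

Lemma fnorm0 : fnorm (0 : 'M[R]_n) = 0.
Proof. by rewrite /fnorm fdot0l sqrtr0. Qed.

Lemma fnormZ a A : fnorm (a *: A) = `|a| * fnorm A.
Proof.
by rewrite /fnorm fdotZl fdotZr mulrA -expr2 sqrtrM ?sqr_ge0 // sqrtr_sqr.
Qed.

Lemma fnormN A : fnorm (- A) = fnorm A.
Proof. by rewrite -scaleN1r fnormZ normrN1 mul1r. Qed.

Lemma fnormT A : fnorm A^T = fnorm A.
Proof. by rewrite /fnorm fdotTT. Qed.

Lemma fnormB_sym A B : fnorm (A - B) = fnorm (B - A).
Proof. by rewrite -fnormN opprB. Qed.

Lemma fdot_le A B : fdot A B <= fnorm A * fnorm B.
Proof.
have [h|h] := leP (fdot A B) 0.
  by apply: (le_trans h); rewrite mulr_ge0 ?fnorm_ge0.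
rewrite -(ler_pXn2r (n := 2)) ?nnegrE ?(ltW h) ?mulr_ge0 ?fnorm_ge0 //.
rewrite exprMn !fnorm_sqr /fdot !pair_bigA /=; exact: sum_cauchy_schwarz.
Qed.

Lemma fdot_le_norm A B : `|fdot A B| <= fnorm A * fnorm B.
Proof. by rewrite ler_norml fdot_le andbT lerNl -fdotNl -(fnormN A) fdot_le. Qed.

Lemma fnormD A B : fnorm (A + B) <= fnorm A + fnorm B.
Proof.
rewrite -(ler_pXn2r (n := 2)) ?nnegrE ?addr_ge0 ?fnorm_ge0 //.
rewrite sqrrD !fnorm_sqr fdotDl !fdotDr (fdotC B A).
have := fdot_le A B; lra.
Qed.

Lemma fnormB A B : fnorm (A - B) <= fnorm A + fnorm B.
Proof. by rewrite -(fnormN B) fnormD. Qed.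

Lemma fnorm_le_sqr A c : 0 <= c -> fdot A A <= c ^+ 2 -> fnorm A <= c.
Proof. by move=> c0 h; rewrite -(ler_pXn2r (n := 2)) ?nnegrE ?fnorm_ge0 // fnorm_sqr. Qed.

Lemma fnorm_delta i j : fnorm (delta_mx i j : 'M[R]_n) = 1.
Proof.
rewrite /fnorm /fdot (bigD1 i) //= [X in _ + X]big1 => [|k /negPf ki]; last first.
  by rewrite big1 // => l _; rewrite !mxE ki mulr0.
rewrite (bigD1 j) //= [X in _ + X + _]big1 => [|k /negPf kj]; last first.
  by rewrite !mxE kj andbF mulr0.
by rewrite !mxE !eqxx mulr1 !addr0 sqrtr1.
Qed.

Lemma fnormM A B : fnorm (A *m B) <= fnorm A * fnorm B.
Proof.
apply: fnorm_le_sqr; first by rewrite mulr_ge0 ?fnorm_ge0.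
rewrite exprMn !fnorm_sqr {1}/fdot.
apply: (@le_trans _ _ (\sum_i \sum_j (\sum_k A i k ^+ 2) * (\sum_k B k j ^+ 2))).
  apply: ler_sum => i _; apply: ler_sum => j _; rewrite -expr2 mxE.
  exact: sum_cauchy_schwarz.
rewrite le_eqVlt; apply/orP; left; apply/eqP.
under eq_bigr do rewrite -mulr_sumr.
rewrite -mulr_suml /fdot; congr (_ * _).
by rewrite exchange_big.
Qed.

Lemma fnorm_orthl (U A : 'M[R]_n) : U^T *m U = 1%:M -> fnorm (U *m A) = fnorm A.
Proof. by move=> h; rewrite /fnorm fdotMl mulmxA h mul1mx. Qed.

Lemma fnorm_orthr (U A : 'M[R]_n) : U^T *m U = 1%:M -> fnorm (A *m U^T) = fnorm A.
Proof. by move=> h; rewrite -fnormT trmx_mul trmxK fnorm_orthl // fnormT. Qed.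

End FrobeniusTheory.

(** * Singular value decomposition *)

Section SVDExistence.
Context {R : realType}.

(** Over the complex numbers [B] becomes Hermitian, and the spectral theorem supplies an eigenvalue
    that is real. It is a root of a characteristic polynomial with real coefficients, so it is
    already an eigenvalue over [R], with a real eigenvector. *)
Lemma symmetric_eigenvector n (B : 'M[R]_n.+1) : B^T = B ->
  exists (a : R) (v : 'rV[R]_n.+1), v *m B = a *: v /\ v != 0.
Proof.
move=> Bsym; pose f := real_complex R; pose B' := map_mx f B.
have Bh : B' \is hermsymmx.
  apply: realsym_hermsym.
    by apply/is_hermitianmxP; rewrite expr0 scale1r map_mx_id // map_trmx Bsym.
  apply/mxOverP => i j; have -> : B' i j = Complex (B i j) 0 by rewrite mxE.
  by rewrite complex_real.
have /hermitian_normalmx/orthomx_spectralP Bd := Bh.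
have dreal := hermitian_spectral_diag_real Bh.
set P := spectralmx B' in Bd; set d := spectral_diag B' in Bd dreal.
have Pu : P \in unitmx by exact: spectral_unit.
have ev : eigenvalue B' (d 0 0).
  apply/eigenvalueP; exists (row 0 P).
    rewrite -row_mul [in LHS]Bd !mulmxA mulmxV // mul1mx row_mul row_diag_mx.
    by rewrite -scalemxAl -rowE.
  apply/eqP => /(congr1 (mulmx^~ (invmx P))); rewrite -row_mul mulmxV // mul0mx.
  by move=> /rowP /(_ 0); rewrite !mxE eqxx => /eqP; rewrite oner_eq0.
have [a da] : exists a, d 0 0 = f a.
  have : d 0 0 \is Num.real by apply/mxOverP.
  by case: (d 0 0) => a b; rewrite complex_real => /eqP ->; exists a.
move: ev; rewrite da eigenvalue_root_char -map_char_poly fmorph_root.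
by rewrite -eigenvalue_root_char => /eigenvalueP [v ? ?]; exists a, v.
Qed.

Lemma dotmx_gt0 n (v : 'rV[R]_n) : v != 0 -> 0 < (v *m v^T) 0 0.
Proof.
have E : (v *m v^T) 0 0 = \sum_i v 0 i ^+ 2.
  by rewrite mxE; apply: eq_bigr => i _; rewrite mxE expr2.
move=> v0; rewrite lt_neqAle E sumr_ge0 ?andbT => [|i _]; last exact: sqr_ge0.
apply: contraNneq v0 => /esym/eqP; rewrite psumr_eq0 => [/allP h|i _]; last exact: sqr_ge0.
apply/eqP/rowP => i; have := h i (mem_index_enum i).
by rewrite /= sqrf_eq0 mxE => /eqP.
Qed.

Lemma unit_row n (v : 'rV[R]_n) : v != 0 ->
  exists2 c : R, c != 0 & (c *: v) *m (c *: v)^T = 1%:M.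
Proof.
move=> /dotmx_gt0 v0; exists (Num.sqrt ((v *m v^T) 0 0))^-1.
  by rewrite invr_eq0 gt_eqF // sqrtr_gt0.
rewrite linearZ /= -scalemxAl -scalemxAr scalerA -expr2 exprVn sqr_sqrtr ?ltW //.
rewrite [X in _ *: X]mx11_scalar scale_scalar_mx mulVf ?gt_eqF //.
Qed.

(* Householder reflection exchanging [u] and the first basis vector. *)
Lemma orthogonal_first_row n (u : 'rV[R]_n.+1) : u *m u^T = 1%:M ->
  exists Q : 'M[R]_n.+1, Q *m Q^T = 1%:M /\ row 0 Q = u.
Proof.
move=> u1; pose e : 'rV[R]_n.+1 := delta_mx 0 0.
have e1 : e *m e^T = 1%:M.
  by rewrite trmx_delta mul_delta_mx; apply/matrixP => i j; rewrite !ord1 !mxE.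
have [->|ue] := eqVneq u e.
  by exists 1%:M; rewrite trmx1 mulmx1; split => //; rewrite row1.
pose w := u - e; have w0 : w != 0 by rewrite subr_eq0.
pose c := (w *m w^T) 0 0; have c0 : c != 0 by rewrite gt_eqF // dotmx_gt0.
have wwT : w *m w^T = c%:M by exact: mx11_scalar.
pose k := (u *m e^T) 0 0; have ueT : u *m e^T = k%:M by exact: mx11_scalar.
have euT : e *m u^T = k%:M by rewrite -[e]trmxK -trmx_mul ueT tr_scalar_mx.
have ck : c = 2 - 2 * k.
  have : w *m w^T = (2 - 2 * k)%:M.
    rewrite /w linearB /= mulmxBl !mulmxBr u1 e1 ueT euT -!raddfB /=; congr (_%:M); ring.
  by move=> h; rewrite /c h mxE eqxx mulr1n.
have eT : e *m w^T = (k - 1)%:M by rewrite /w linearB /= mulmxBr euT e1 -raddfB.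
pose Q : 'M[R]_n.+1 := 1%:M - (2 / c) *: (w^T *m w).
have QT : Q^T = Q by rewrite /Q linearB /= linearZ /= trmx_mul trmxK trmx1.
exists Q; split.
  have K : (w^T *m w) *m (w^T *m w) = c *: (w^T *m w).
    by rewrite mulmxA -[w^T *m w *m w^T]mulmxA wwT mul_mx_scalar -scalemxAl.
  rewrite QT /Q; move: (w^T *m w) K => N K.
  rewrite mulmxBl mul1mx mulmxBr mulmx1 -scalemxAl -scalemxAr K !scalerA.
  have -> : 2 / c * (2 / c) * c = 2 / c + 2 / c by field.
  by rewrite scalerDl opprB addrK subrK.
rewrite rowE -/e /Q mulmxBr mulmx1 -scalemxAr mulmxA eT mul_scalar_mx scalerA.
have -> : 2 / c * (k - 1) = -1 by move: c0; rewrite ck => c0; field.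
by rewrite scaleN1r opprK /w addrC subrK.
Qed.

(** Take a unit eigenvector [u] of [A A^T] with eigenvalue [a]. If [u A] is nonzero, then
    [a = |u A|^2], and [x = sqrt a], [v = u A / x] work. If [u A = 0], then [A] is singular,
    [x = 0], and [v] is any unit vector of the kernel of [A^T]. *)
Lemma singular_pair n (A : 'M[R]_n.+1) :
  exists (x : R) (u v : 'rV[R]_n.+1), [/\ 0 <= x, u *m u^T = 1%:M, v *m v^T = 1%:M,
    u *m A = x *: v & v *m A^T = x *: u].
Proof.
have [|a [u0 [au0 u0n0]]] := @symmetric_eigenvector n (A *m A^T).
  by rewrite trmx_mul trmxK.
have [c c0 u1] := unit_row u0n0; set u := c *: u0 in u1.
have au : u *m (A *m A^T) = a *: u by rewrite -scalemxAl au0 !scalerA mulrC.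
have un0 : u != 0 by rewrite scaler_eq0 negb_or c0.
have [uA0|uA0] := eqVneq (u *m A) 0.
  have kn0 : kermx A^T != 0.
    rewrite kermx_eq0 row_free_unit unitmx_tr; apply: contraNN un0 => Au.
    by rewrite -(mulmxK Au u) uA0 mul0mx.
  rewrite -nz_row_eq0 in kn0; have [d d0 v1] := unit_row kn0.
  exists 0, u, (d *: nz_row (kermx A^T)); split => //.
    by rewrite uA0 scale0r.
  have /sub_kermxP h := nz_row_sub (kermx A^T).
  by rewrite -scalemxAl h scaler0 scale0r.
have aE : a = ((u *m A) *m (u *m A)^T) 0 0.
  by rewrite trmx_mul mulmxA -(mulmxA u) au -scalemxAl u1 !mxE mulr1.
have a0 : 0 < a by rewrite aE dotmx_gt0.
have x0 : 0 < Num.sqrt a by rewrite sqrtr_gt0.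
have xa : Num.sqrt a ^+ 2 = a by rewrite sqr_sqrtr ?ltW.
exists (Num.sqrt a), u, ((Num.sqrt a)^-1 *: (u *m A)); split => //.
- exact: ltW.
- rewrite linearZ /= -scalemxAl -scalemxAr scalerA -expr2 exprVn xa.
  by rewrite [X in _ *: X]mx11_scalar -aE scale_scalar_mx mulVf ?gt_eqF.
- by rewrite scalerA divff ?gt_eqF // scale1r.
- by rewrite -scalemxAl -mulmxA au scalerA -{2}xa expr2 mulKf ?gt_eqF.
Qed.

(** Deflation: in orthonormal bases starting with a singular pair [u], [v], the first row and the
    first column of [A] vanish off the diagonal, and the induction hypothesis treats the lower right
    block. Any singular pair will do, so the values come out unordered. *)
Lemma svd_unsorted n (A : 'M[R]_n) :
  exists (U : 'M[R]_n) (s : 'rV[R]_n) (V : 'M[R]_n),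
    [/\ U^T *m U = 1%:M, V^T *m V = 1%:M, forall i, 0 <= s 0 i &
        A = U *m diag_mx s *m V^T].
Proof.
elim: n A => [|n IH] A.
  exists 1%:M, 0, 1%:M; split; rewrite ?trmx1 ?mulmx1 //; first by case.
  by rewrite [LHS]flatmx0 [RHS]flatmx0.
have [x [u [v [x0 u1 v1 uA vA]]]] := singular_pair A.
have [Qu [Qu1 Qu0]] := orthogonal_first_row u1.
have [Qv [Qv1 Qv0]] := orthogonal_first_row v1.
pose M : 'M[R]_(1 + n) := Qu *m A *m Qv^T.
have rM : row 0 M = x *: row 0 1%:M.
  by rewrite !row_mul Qu0 uA -scalemxAl -Qv0 -row_mul Qv1.
have cM : row 0 M^T = x *: row 0 1%:M.
  by rewrite !trmx_mul trmxK mulmxA !row_mul Qv0 vA -scalemxAl -Qu0 -row_mul Qu1.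
have [U [s [V [U1 V1 s0 ME]]]] := IH (drsubmx M).
have MB : M = block_mx x%:M 0 0 (drsubmx M).
  have l0 : lshift n (0 : 'I_1) = 0 :> 'I_(1 + n) by apply: val_inj.
  rewrite -[LHS]submxK; congr (block_mx _ _ _ _); apply/matrixP => i j; rewrite ?ord1 !mxE l0.
  - by have /rowP /(_ 0) := rM; rewrite !mxE eqxx mulr1.
  - by have /rowP /(_ (rshift 1 j)) := rM; rewrite !mxE => ->; rewrite mulr0.
  - by have /rowP /(_ (rshift 1 i)) := cM; rewrite !mxE => ->; rewrite mulr0.
have blk1 (W : 'M[R]_n) : W^T *m W = 1%:M ->
    (block_mx 1%:M 0 0 W : 'M[R]_(1 + n))^T *m block_mx 1%:M 0 0 W = 1%:M.
  move=> W1; rewrite tr_block_mx mulmx_block !trmx0 trmx1 !mulmx0 !mul0mx W1.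
  by rewrite !mulmx1 ?addr0 ?add0r -scalar_mx_block.
have orth (Q W : 'M[R]_n.+1) : Q *m Q^T = 1%:M -> W^T *m W = 1%:M ->
    (Q^T *m W)^T *m (Q^T *m W) = 1%:M.
  by move=> Q1 W1; rewrite trmx_mul trmxK mulmxA -(mulmxA W^T) Q1 mulmx1.
pose blk (W : 'M[R]_n) : 'M[R]_(1 + n) := block_mx 1%:M 0 0 W.
pose d : 'rV[R]_(1 + n) := row_mx x%:M s.
exists (Qu^T *m blk U), d, (Qv^T *m blk V); split.
- exact: orth Qu1 (blk1 _ U1).
- exact: orth Qv1 (blk1 _ V1).
- move=> i; rewrite mxE; case: fintype.splitP => j _ //; by rewrite mxE ord1 eqxx.
rewrite trmx_mul trmxK !mulmxA -(mulmxA Qu^T) -(mulmxA Qu^T).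
have -> : blk U *m diag_mx d *m (blk V)^T = M.
  rewrite MB ME /blk /d diag_mx_row tr_block_mx !mulmx_block.
  have z0 : diag_mx (x%:M : 'rV[R]_1) = x%:M.
    by apply/matrixP => i j; rewrite !ord1 !mxE.
  by rewrite !(trmx0, trmx1, mulmx0, mul0mx, addr0, add0r, mul1mx, mulmx1) z0.
by rewrite /M !mulmxA (mulmx1C Qu1) mul1mx -mulmxA (mulmx1C Qv1) mulmx1.
Qed.

Lemma svd_exists n (A : 'M[R]_n) :
  exists (U : 'M[R]_n) (s : 'rV[R]_n) (V : 'M[R]_n), is_svd A U s V.
Proof.
have [U [s [V [U1 V1 s0 AE]]]] := svd_unsorted A.
pose t := [tuple s 0 i | i < n].
have /tuple_permP [q tq] : perm_eq (sort >=%R t) t by rewrite perm_sort.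
have qE (i : 'I_n) : nth 0 (sort >=%R t) (val i) = s 0 (q i).
  by rewrite tq -tnth_nth !tnth_mktuple.
have colq (W : 'M[R]_n) : W^T *m W = 1%:M -> (col_perm q W)^T *m col_perm q W = 1%:M.
  move=> W1; apply/matrixP => i j; have /matrixP /(_ (q i) (q j)) := W1.
  rewrite !mxE (inj_eq perm_inj) => <-; apply: eq_bigr => k _; by rewrite !mxE.
exists (col_perm q U), (\row_i s 0 (q i)), (col_perm q V); split; last by move=> i; rewrite mxE.
split; [exact: colq|exact: colq| |].
- move=> i j ij; rewrite !mxE -!qE.
  have sz : size (sort >=%R t) = n by rewrite size_sort size_tuple.
  have tr : transitive (>=%R : rel R) by move=> a b c ab bc; exact: le_trans bc ab.
  have so : sorted >=%R (sort >=%R t) by apply: sort_sorted => a b; exact: le_total.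
  have rf : reflexive (>=%R : rel R) by move=> a; exact: lexx.
  by have := sorted_leq_nth tr rf 0 so =>  /(_ i j); apply; rewrite ?inE ?sz.
- rewrite {1}AE !mul_mx_diag; apply/matrixP => i j; rewrite !mxE.
  rewrite (reindex_inj (@perm_inj _ q)) /=; apply: eq_bigr => k _.
  by rewrite !mxE.
Qed.

End SVDExistence.

(** * Tangent spaces *)

Section OrthogonalProjectors.
Context {R : realType} {n : nat}.
Implicit Types (A M P Q Z : 'M[R]_n).

Definition orth_projector P := P^T = P /\ P *m P = P.

Lemma orth_projectorC P : orth_projector P -> orth_projector (1%:M - P).
Proof.
move=> [PT PP]; split; first by rewrite linearB /= trmx1 PT.
by rewrite mulmxBl mul1mx mulmxBr mulmx1 PP subrr subr0.
Qed.

Lemma orth_projector_gram (r : nat) (U : 'M[R]_(n, r)) :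
  U^T *m U = 1%:M -> orth_projector (U *m U^T).
Proof.
move=> U1; split; first by rewrite trmx_mul trmxK.
by rewrite mulmxA -(mulmxA U) U1 mulmx1.
Qed.

Lemma fdot_projl_split P A : orth_projector P ->
  fdot A A = fdot (P *m A) (P *m A) + fdot ((1%:M - P) *m A) ((1%:M - P) *m A).
Proof.
move=> hP; have [CT CC] := orth_projectorC hP; have [PT PP] := hP.
rewrite (fdotMl P) PT mulmxA PP (fdotMl (1%:M - P)) CT mulmxA CC -fdotDr.
by rewrite -mulmxDl addrC subrK mul1mx.
Qed.

Lemma fnorm_projl P A : orth_projector P -> fnorm (P *m A) <= fnorm A.
Proof.
move=> hP; apply: ler_wsqrtr; rewrite (fdot_projl_split A hP).
by rewrite lerDl fdot_ge0.
Qed.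

Lemma fnorm_projr P A : orth_projector P -> fnorm (A *m P) <= fnorm A.
Proof. by move=> hP; rewrite -fnormT trmx_mul hP.1 -(fnormT A); exact: fnorm_projl. Qed.

(* With [P], [Q] the projectors onto the column and row space of [Y], this is
   the orthogonal projection onto the tangent space at [Y]. *)
Definition tproj P Q Z : 'M[R]_n := Z - (1%:M - P) *m Z *m (1%:M - Q).

Lemma tprojD P Q A Z : tproj P Q (A + Z) = tproj P Q A + tproj P Q Z.
Proof. by rewrite /tproj (mulmxDr (1%:M - P)) (mulmxDl _ _ (1%:M - Q)) opprD addrACA. Qed.

Lemma tprojZ P Q a Z : tproj P Q (a *: Z) = a *: tproj P Q Z.
Proof. by rewrite /tproj -scalemxAr -scalemxAl scalerBr. Qed.

Lemma tprojN P Q Z : tproj P Q (- Z) = - tproj P Q Z.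
Proof. by rewrite -scaleN1r tprojZ scaleN1r. Qed.

Lemma tprojB P Q A Z : tproj P Q (A - Z) = tproj P Q A - tproj P Q Z.
Proof. by rewrite tprojD tprojN. Qed.

Lemma tproj_adj P Q A Z : orth_projector P -> orth_projector Q ->
  fdot (tproj P Q A) Z = fdot A (tproj P Q Z).
Proof.
move=> /orth_projectorC [PT _] /orth_projectorC [QT _].
by rewrite /tproj fdotBl fdotBr fdotMr QT fdotMl PT mulmxA.
Qed.

Lemma tprojK P Q Z : orth_projector P -> orth_projector Q ->
  tproj P Q (tproj P Q Z) = tproj P Q Z.
Proof.
move=> /orth_projectorC [_ PP] /orth_projectorC [_ QQ].
rewrite {1}/tproj; suff -> : (1%:M - P) *m tproj P Q Z *m (1%:M - Q) = 0 by rewrite subr0.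
rewrite /tproj; move: (1%:M - P) (1%:M - Q) PP QQ => P' Q' PP QQ.
by rewrite mulmxBr mulmxBl !mulmxA PP -!(mulmxA _ Q') QQ subrr.
Qed.

Lemma fnorm_tproj P Q Z : orth_projector P -> orth_projector Q ->
  fnorm (tproj P Q Z) <= fnorm Z.
Proof.
move=> hP hQ; have [h|h] := leP (fnorm (tproj P Q Z)) 0.
  exact: le_trans h (fnorm_ge0 _).
by rewrite -(ler_pM2l h) -expr2 fnorm_sqr tproj_adj // tprojK // fdotC fdot_le.
Qed.

End OrthogonalProjectors.

Section TangentSpace.
Context {R : realType} {n : nat}.
Implicit Types (Y M Z : 'M[R]_n).

(** Inverting [s] gives [U = Y V s^-1] and [V = Y^T U s^-1], so whatever fixes [Y] fixes the
    singular vectors of every reduced SVD. This makes the union over all reduced SVDs in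
    [tangent_space] collapse to a single space. *)
Lemma reduced_svd_colspace (r : nat) Y (U V : 'M[R]_(n, r)) s P Q :
  is_reduced_svd Y U s V -> P *m Y = Y -> Y *m Q = Y -> Q^T = Q ->
  P *m U = U /\ Q *m V = V.
Proof.
move=> [[U1 V1 _ YE] s0] PY YQ QT; pose si := \row_i (s 0 i)^-1 : 'rV[R]_r.
have D1 : diag_mx s *m diag_mx si = 1%:M.
  apply/matrixP => i j; rewrite mul_mx_diag !mxE; case: eqVneq => [->|_]; last by rewrite mul0r.
  by rewrite mulr1n divff // gt_eqF.
have UE : U = Y *m (V *m diag_mx si).
  by rewrite YE mulmxA -(mulmxA _ V^T) V1 mulmx1 -mulmxA D1 mulmx1.
have VE : V = Y^T *m (U *m diag_mx si).
  rewrite YE !trmx_mul trmxK tr_diag_mx !mulmxA -(mulmxA _ U^T) U1 mulmx1.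
  by rewrite -mulmxA D1 mulmx1.
split; first by rewrite UE mulmxA PY.
by rewrite VE mulmxA -{1}QT -trmx_mul YQ.
Qed.

Lemma tangent_projE (r : nat) Y (U V : 'M[R]_(n, r)) s Z :
  is_reduced_svd Y U s V ->
  tangent_proj r Y Z = tproj (U *m U^T) (V *m V^T) Z.
Proof.
move=> hY; have [[U1 V1 _ YE] s0] := hY.
have hP := orth_projector_gram U1; have hQ := orth_projector_gram V1.
set P := U *m U^T in hP *; set Q := V *m V^T in hQ *.
have PY : P *m Y = Y by rewrite YE /P !mulmxA -(mulmxA U) U1 mulmx1.
have YQ : Y *m Q = Y by rewrite YE /Q !mulmxA -(mulmxA _ V^T) V1 mulmx1.
have TW W : tangent_space r Y W -> tproj P Q W = W.
  move=> [U' [s' [V' [hY' [Z1 [Z2 ->]]]]]].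
  have [PU QV] := reduced_svd_colspace hY' PY YQ hQ.1.
  have PU0 : (1%:M - P) *m U' = 0 by rewrite mulmxBl mul1mx PU subrr.
  have QV0 : V'^T *m (1%:M - Q) = 0 by rewrite mulmxBr mulmx1 -hQ.1 -trmx_mul QV subrr.
  rewrite /tproj; move: (1%:M - P) (1%:M - Q) PU0 QV0 => P' Q' PU0 QV0.
  by rewrite mulmxDr mulmxDl !mulmxA PU0 !mul0mx add0r -mulmxA QV0 mulmx0 subr0.
have WT W : tangent_space r Y (tproj P Q W).
  (* The witnesses come from the splitting [P W + (1 - P) W Q] of the projection. *)
  exists U, s, V; split => //; exists (U^T *m W)^T, ((1%:M - P) *m W *m V).
  rewrite trmxK -(mulmxA _ V) -/Q mulmxA -/P /tproj mulmxBr mulmx1 opprB.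
  rewrite addrA addrAC; congr (_ + _).
  by rewrite mulmxBl mul1mx opprB addrC subrK.
rewrite /tangent_proj /orth_proj; apply: xget_unique => /=.
  split=> [|V0 /TW TV]; first exact: WT.
  by rewrite -TV -tproj_adj // tprojB tprojK // subrr fdot0l.
(* Uniqueness: the difference of two candidates is tangent and orthogonal to every tangent vector,
   hence to itself. *)
move=> W [/TW TWW h]; apply/eqP; rewrite -subr_eq0; apply/eqP/fdot_eq0.
have TD : tproj P Q (W - tproj P Q Z) = W - tproj P Q Z by rewrite tprojB TWW tprojK.
have := h (W - tproj P Q Z); rewrite -{1}TD => /(_ (WT _)).
rewrite -{1}TD -tproj_adj // tprojB TWW => e.
by rewrite -{1}[W - _]opprB fdotNl e oppr0.
Qed.

End TangentSpace.

(** * Leading singular vectors and the smallest nonzero singular value *)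

Section TruncatedSVD.
Context {R : realType} {n : nat}.
Implicit Types (Y M Z : 'M[R]_n).

Definition head_row (r : nat) : 'rV[R]_n := \row_i (i < r)%:R.

(** [Y] has the rank of [diag_mx s]. As [s] decreases, [s_i > 0] makes the first [i + 1] entries
    invertible, while [s_i = 0] kills all entries from [i] on. *)
Lemma svd_rank Y (U : 'M[R]_n) s (V : 'M[R]_n) : is_svd Y U s V ->
  forall i, (0 < s 0 i) = (i < \rank Y)%N.
Proof.
move=> [[U1 V1 srt YE] s0] i.
have DE : diag_mx s = U^T *m Y *m V.
  by rewrite YE !mulmxA U1 mul1mx -mulmxA V1 mulmx1.
have rk : \rank (diag_mx s) = \rank Y.
  apply/eqP; rewrite eqn_leq; apply/andP; split.
    by rewrite DE (leq_trans (mxrankM_maxl _ _)) ?mxrankM_maxr.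
  by rewrite YE (leq_trans (mxrankM_maxl _ _)) ?mxrankM_maxr.
apply/idP/idP => [si|].
  have E : pid_mx i.+1 = diag_mx (\row_j if (j <= i)%N then (s 0 j)^-1 else 0) *m diag_mx s.
    apply/matrixP => j k; rewrite mul_mx_diag !mxE ltnS.
    rewrite -[(j == k :> nat)]/(j == k).
    have [->|_] := eqVneq j k; last by rewrite mulr0n mul0r.
    rewrite /= mulr1n; case: ifP => [ki|_]; last by rewrite mul0r.
    by rewrite mulVf // gt_eqF // (lt_le_trans si) // srt.
  have := mxrankM_maxr (diag_mx (\row_j if (j <= i)%N then (s 0 j)^-1 else 0)) (diag_mx s).
  by rewrite -E rk rank_pid_mx.
apply: contraTT; rewrite -leNgt -leqNgt => si.
have s00 (j : 'I_n) : (i <= j)%N -> s 0 j = 0.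
  by move=> ij; apply/eqP; rewrite eq_le s0 andbT (le_trans (srt _ _ ij)).
have E : diag_mx s = diag_mx s *m pid_mx i.
  apply/matrixP => j k; rewrite mul_diag_mx !mxE.
  rewrite -[(j == k :> nat)]/(j == k).
  have [_|_] := eqVneq j k; last by rewrite mulr0n mulr0.
  by rewrite /= mulr1n; case: ltnP => [_|/s00 ->]; rewrite ?mulr1 ?mul0r.
rewrite -rk E; apply: (leq_trans (mxrankM_maxr _ _)).
by rewrite rank_pid_mx // ltnW.
Qed.

Lemma head_projector_ge (r : nat) (U V : 'M[R]_n) (s : 'rV[R]_n) (c : R) M :
  U^T *m U = 1%:M -> V^T *m V = 1%:M -> 0 <= c ->
  (forall i : 'I_n, (i < r)%N -> c <= s 0 i) ->
  c * fnorm (M *m (U *m diag_mx (head_row r) *m U^T)) <=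
  fnorm (M *m (U *m diag_mx s *m V^T)).
Proof.
move=> U1 V1 c0 cs; rewrite !mulmxA !fnorm_orthr //.
apply: (le_trans (y := fnorm (c *: (M *m U *m diag_mx (head_row r))))).
  by rewrite fnormZ ger0_norm.
apply: ler_wsqrtr; apply: ler_sum => i _; apply: ler_sum => j _.
rewrite !mul_mx_diag !mxE -!expr2 !exprMn.
case: ltnP => [/cs h|_]; last by rewrite expr0n /= !mulr0 mulr_ge0 ?sqr_ge0.
rewrite expr1n mulr1 mulrC; apply: ler_wpM2l; first exact: sqr_ge0.
by rewrite ler_pXn2r ?nnegrE // (le_trans c0).
Qed.

Section Restriction.
Variables (r : nat) (rn : (r <= n)%N).

(** The first [r] columns: the passage from a full SVD to the [n] by [r] factors that
    [tangent_space] asks for. *)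
Let heads (U : 'M[R]_n) : 'M[R]_(n, r) := \matrix_(i, j) U i (widen_ord rn j).

Lemma sum_heads (F : 'I_n -> R) : (forall i : 'I_n, (r <= i)%N -> F i = 0) ->
  \sum_i F i = \sum_(i < r) F (widen_ord rn i).
Proof.
move=> F0; rewrite (bigID (fun i : 'I_n => (i < r)%N)) /= [X in _ + X]big1 ?addr0.
  by rewrite (big_ord_narrow rn).
by move=> i; rewrite -leqNgt => /F0.
Qed.

Lemma heads_orth U : U^T *m U = 1%:M -> (heads U)^T *m heads U = 1%:M.
Proof.
move=> U1; apply/matrixP => i j.
have /matrixP /(_ (widen_ord rn i) (widen_ord rn j)) := U1.
by rewrite !mxE => h; rewrite -[RHS]h; apply: eq_bigr => k _; rewrite !mxE.
Qed.

Lemma heads_mul U V (s : 'rV[R]_n) : (forall i : 'I_n, (r <= i)%N -> s 0 i = 0) ->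
  U *m diag_mx s *m V^T = heads U *m diag_mx (\row_i s 0 (widen_ord rn i)) *m (heads V)^T.
Proof.
move=> s0; apply/matrixP => i j; rewrite !mul_mx_diag !mxE sum_heads.
  by apply: eq_bigr => k _; rewrite !mxE.
by move=> k /s0 sk; rewrite !mxE sk mulr0 mul0r.
Qed.

Lemma heads_gram U : heads U *m (heads U)^T = U *m diag_mx (head_row r) *m U^T.
Proof.
rewrite heads_mul => [|i ri]; last by rewrite mxE ltnNge ri.
suff -> : diag_mx (\row_i head_row r 0 (widen_ord rn i)) = 1%:M by rewrite mulmx1.
by apply/matrixP => i j; rewrite !mxE /= ltn_ord.
Qed.

End Restriction.

(** The traces are recorded because the comparison of two projectors, and the weights in the best
    approximation argument, depend on [P] and [Q] having rank [r]. *)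
Lemma rank_tangent_proj (r : nat) Y (U : 'M[R]_n) s (V : 'M[R]_n) :
  is_svd Y U s V -> \rank Y = r ->
  let P := U *m diag_mx (head_row r) *m U^T in
  let Q := V *m diag_mx (head_row r) *m V^T in
  [/\ orth_projector P, orth_projector Q, \tr P = r%:R, \tr Q = r%:R &
   [/\ P *m Y = Y, Y *m Q = Y & forall Z, tangent_proj r Y Z = tproj P Q Z]].
Proof.
move=> hY rY P Q; have sp := svd_rank hY; rewrite rY in sp.
have [[U1 V1 srt YE] s0] := hY.
have rn : (r <= n)%N by rewrite -rY rank_leq_row.
rewrite /P /Q -!(heads_gram rn).
set Ur := (\matrix_(i, j) U i _); set Vr := (\matrix_(i, j) V i _).
have Ur1 : Ur^T *m Ur = 1%:M by exact: heads_orth.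
have Vr1 : Vr^T *m Vr = 1%:M by exact: heads_orth.
have YrE : Y = Ur *m diag_mx (\row_i s 0 (widen_ord rn i)) *m Vr^T.
  rewrite YE -heads_mul // => i ri; apply/eqP; rewrite eq_le s0 andbT leNgt sp.
  by rewrite -leqNgt.
split; try exact: orth_projector_gram.
- by rewrite mxtrace_mulC Ur1 mxtrace1.
- by rewrite mxtrace_mulC Vr1 mxtrace1.
split.
- by rewrite YrE !mulmxA -(mulmxA Ur) Ur1 mulmx1.
- by rewrite YrE !mulmxA -(mulmxA _ Vr^T) Vr1 mulmx1.
move=> Z; apply: (tangent_projE (s := \row_i s 0 (widen_ord rn i))); split.
  by split=> // i j ij; rewrite !mxE; exact: srt.
by move=> i; rewrite mxE sp /= ltn_ord.
Qed.

(** [sigma_min] is an infimum over the singular values of all SVDs, so it is at most each of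
    [s_0, ..., s_(r-1)], which gives both inequalities. For positivity, every nonzero singular value
    from any other SVD must be shown to be at least [s_(r-1)]. *)
Lemma sigma_min_bounds (r : nat) Y (U : 'M[R]_n) s (V : 'M[R]_n) :
  is_svd Y U s V -> \rank Y = r -> (0 < r)%N ->
  let P := U *m diag_mx (head_row r) *m U^T in
  let Q := V *m diag_mx (head_row r) *m V^T in
  [/\ 0 < sigma_min Y,
      forall M, sigma_min Y * fnorm (M *m P) <= fnorm (M *m Y) &
      forall M, sigma_min Y * fnorm (Q *m M) <= fnorm (Y *m M)].
Proof.
move=> hY rY r0 P Q; have [hP hQ _ _ [PY YQ _]] := rank_tangent_proj hY rY.
rewrite -/P -/Q in hP hQ PY YQ.
have sp := svd_rank hY; rewrite rY in sp; have [[U1 V1 srt YE] s0] := hY.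
have rn : (r <= n)%N by rewrite -rY rank_leq_row.
have ge_l c M : 0 <= c -> (forall i : 'I_n, (i < r)%N -> c <= s 0 i) ->
    c * fnorm (M *m P) <= fnorm (M *m Y).
  by move=> c0 cs; rewrite [in leRHS]YE; exact: head_projector_ge.
have ge_r c M : 0 <= c -> (forall i : 'I_n, (i < r)%N -> c <= s 0 i) ->
    c * fnorm (Q *m M) <= fnorm (Y *m M).
  move=> c0 cs; rewrite -(fnormT (Q *m M)) (trmx_mul Q M) hQ.1.
  rewrite -(fnormT (Y *m M)) (trmx_mul Y M) YE !trmx_mul trmxK tr_diag_mx.
  by rewrite (mulmxA V); exact: head_projector_ge.
have last_lt : (r.-1 < n)%N by rewrite prednK.
pose last := Ordinal last_lt; pose c := s 0 last.
have c0 : 0 < c by rewrite sp /= prednK.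
have cs (i : 'I_n) : (i < r)%N -> c <= s 0 i by move=> ir; apply: srt; rewrite /= -ltnS prednK.
have sigma_lb (i : 'I_n) : (i < r)%N -> sigma_min Y <= s 0 i.
  move=> ir; apply: ge_inf; last first.
    by split; [exists U, s, V, i | rewrite gt_eqF // sp].
  by exists 0 => x [[U' [s' [V' [j [[_ s'0] ->]]]]] _].
have sigma0 : 0 < sigma_min Y.
  apply: (lt_le_trans c0); apply: lb_le_inf.
    by exists c; split; [exists U, s, V, last | rewrite gt_eqF].
  move=> _ [[U' [s' [V' [i [[[U'1 V'1 _ Y'E] s'0] ->]]]]] xn0].
  (* Multiplying by [D] isolates the [i]-th singular vector while keeping matrices square, so that
     [fnorm] applies. The vector [v] lies in the row space of [Y], whence
     [s_(r-1) |v| <= |Y v| = x |v|]. *)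
  pose D : 'M[R]_n := delta_mx i i; set x := s' 0 i in xn0 *.
  have sD : diag_mx s' *m D = x *: D.
    apply/matrixP => j k; rewrite mul_diag_mx !mxE.
    by case: eqVneq => [->|_] //; rewrite !mulr0.
  have YV : Y *m (V' *m D) = x *: (U' *m D).
    by rewrite Y'E mulmxA -(mulmxA _ V'^T) V'1 mulmx1 -mulmxA sD -scalemxAr.
  have YU : Y^T *m (U' *m D) = x *: (V' *m D).
    rewrite Y'E !trmx_mul trmxK tr_diag_mx !mulmxA -(mulmxA _ U'^T) U'1 mulmx1.
    by rewrite -mulmxA sD -scalemxAr.
  have QV : Q *m (V' *m D) = V' *m D.
    apply: (scalerI xn0); rewrite (scalemxAr x Q) -YU (mulmxA Q); congr (_ *m _).
    by have := congr1 trmx YQ; rewrite (trmx_mul Y Q) hQ.1.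
  have := ge_r c (V' *m D) (ltW c0) cs.
  by rewrite QV YV fnormZ !fnorm_orthl // fnorm_delta !mulr1 ger0_norm ?s'0.
by split => // M; [apply: ge_l | apply: ge_r] => //; exact: ltW.
Qed.

End TruncatedSVD.

(** * Perturbation of tangent spaces and best approximation *)

Section Perturbation.
Context {R : realType} {n : nat}.
Implicit Types (M P Q X Y Z : 'M[R]_n).

Definition tangent_frame (r : nat) Y P Q :=
  [/\ orth_projector P, orth_projector Q, \tr P = r%:R, \tr Q = r%:R &
      P *m Y = Y /\ Y *m Q = Y].

(** For projectors of equal trace the right-hand side is symmetric in [P] and [Q]. *)
Lemma fdot_projC_proj P Q : orth_projector P -> orth_projector Q ->
  fdot ((1%:M - Q) *m P) ((1%:M - Q) *m P) = \tr P - \tr (Q *m P).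
Proof.
move=> [PT PP] /orth_projectorC [CT CC].
rewrite fdotMl CT mulmxA CC fdot_tr PT mxtrace_mulC -mulmxA PP.
by rewrite mulmxBl mul1mx linearB.
Qed.

(* [P' - P] maps the range of [P] and its complement into orthogonal subspaces,
   with the two restrictions [(1 - P') P] and [P' (1 - P)] of equal Frobenius
   norm because the traces agree; this saves the factor [sqrt 2]. *)
Lemma projB_bound P P' d M : orth_projector P -> orth_projector P' ->
  \tr P = \tr P' -> fnorm ((1%:M - P') *m P) <= d ->
  fnorm ((P' - P) *m M) <= d * fnorm M.
Proof.
move=> hP hP' trP hd; have d0 : 0 <= d := le_trans (fnorm_ge0 _) hd.
have hd' : fnorm (P' *m (1%:M - P)) <= d.
  rewrite -fnormT trmx_mul (orth_projectorC hP).1 hP'.1.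
  move: hd; rewrite /fnorm !fdot_projC_proj // trP.
  by rewrite [\tr (P' *m P)]mxtrace_mulC.
have [PT PP] := hP; have [PT' PP'] := hP'.
apply: fnorm_le_sqr; first by rewrite mulr_ge0 ?fnorm_ge0.
rewrite (fdot_projl_split _ hP').
have -> : P' *m ((P' - P) *m M) = P' *m (1%:M - P) *m ((1%:M - P) *m M).
  rewrite -[in RHS]mulmxA [_ *m ((1%:M - P) *m M)]mulmxA (orth_projectorC hP).2.
  by rewrite !mulmxA mulmxBr PP' mulmxBr mulmx1.
have -> : (1%:M - P') *m ((P' - P) *m M) = - ((1%:M - P') *m P *m (P *m M)).
  rewrite -[in RHS]mulmxA [P *m (P *m M)]mulmxA PP !mulmxA -mulNmx; congr (_ *m _).
  by rewrite mulmxBr [_ *m P']mulmxBl PP' mul1mx subrr sub0r.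
rewrite -!fnorm_sqr fnormN exprMn (fnorm_sqr M) (fdot_projl_split M hP) -!fnorm_sqr addrC mulrDr.
rewrite -!exprMn; apply: lerD; rewrite ler_pXn2r ?nnegrE ?mulr_ge0 ?fnorm_ge0 //.
  by apply: (le_trans (fnormM _ _)); rewrite ler_wpM2r ?fnorm_ge0.
by apply: (le_trans (fnormM _ _)); rewrite ler_wpM2r ?fnorm_ge0.
Qed.

Section TwoPoints.
Variables (r : nat) (X Y P Q P' Q' : 'M[R]_n) (sigma : R).
Hypotheses (hX : tangent_frame r X P Q) (hY : tangent_frame r Y P' Q').
Hypothesis sigma_gt0 : 0 < sigma.
Hypothesis sigmaP : forall M, sigma * fnorm (M *m P) <= fnorm (M *m X).
Hypothesis sigmaQ : forall M, sigma * fnorm (Q *m M) <= fnorm (X *m M).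

(** [P'] fixes [Y], so [(1 - P') X = (1 - P') (X - Y)]. The bound [sigmaP] then trades [X] for its
    projector [P] at the price of [1 / sigma]. *)
Lemma projC_proj_bound : fnorm ((1%:M - P') *m P) <= fnorm (Y - X) / sigma.
Proof.
have [_ _ _ _ [PX XQ]] := hX; have [hP' hQ' _ _ [PY YQ]] := hY.
rewrite ler_pdivlMr // mulrC (le_trans (sigmaP _)) //.
have -> : (1%:M - P') *m X = (1%:M - P') *m (X - Y).
  by rewrite mulmxBr [_ *m Y]mulmxBl mul1mx PY subrr subr0.
by rewrite fnormB_sym; apply: fnorm_projl; exact: orth_projectorC.
Qed.

Lemma proj_projC_bound : fnorm ((1%:M - Q') *m Q) <= fnorm (Y - X) / sigma.
Proof.
have [_ hQ _ _ [PX XQ]] := hX; have [hP' hQ' _ _ [PY YQ]] := hY.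
rewrite -fnormT trmx_mul hQ.1 (orth_projectorC hQ').1.
rewrite ler_pdivlMr // mulrC (le_trans (sigmaQ _)) //.
have -> : X *m (1%:M - Q') = (X - Y) *m (1%:M - Q').
  by rewrite mulmxBl [Y *m _]mulmxBr mulmx1 YQ subrr subr0.
by rewrite fnormB_sym; apply: fnorm_projr; exact: orth_projectorC.
Qed.

(** The residual factors as [(1 - P') P] times [(X - Y) (1 - Q')]. Both factors are of first order
    in [Y - X], so the residual is of second order. *)
Lemma tproj_residual :
  fnorm (X - tproj P' Q' X) <= fnorm (Y - X) / sigma * fnorm (Y - X).
Proof.
have [_ hQ _ _ [PX XQ]] := hX; have [hP' hQ' _ _ [PY YQ]] := hY.
rewrite /tproj opprB addrC subrK.
have -> : (1%:M - P') *m X *m (1%:M - Q')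
        = (1%:M - P') *m P *m ((X - Y) *m (1%:M - Q')).
  rewrite [(X - Y) *m _]mulmxBl [Y *m _]mulmxBr mulmx1 YQ subrr subr0.
  by rewrite [RHS]mulmxA -[_ *m P *m X]mulmxA PX.
apply: (le_trans (fnormM _ _)); apply: ler_pM; rewrite ?fnorm_ge0 //.
  exact: projC_proj_bound.
by rewrite (fnormB_sym Y); apply: fnorm_projr; exact: orth_projectorC.
Qed.

Lemma tprojB_bound Z :
  fnorm (tproj P' Q' Z - tproj P Q Z) <= 2 * (fnorm (Y - X) / sigma) * fnorm Z.
Proof.
have [hP hQ tP tQ _] := hX; have [hP' hQ' tP' tQ' _] := hY.
(* Changing one projector at a time leaves two terms, each at most
   [fnorm (Y - X) / sigma * fnorm Z]. *)
have -> : tproj P' Q' Z - tproj P Q Z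
        = (P' - P) *m (Z *m (1%:M - Q)) + (1%:M - P') *m (Z *m (Q' - Q)).
  rewrite /tproj opprB addrC addrA subrK.
  have -> : P' - P = (1%:M - P) - (1%:M - P') by rewrite opprB [RHS]addrC addrA subrK.
  have -> : Q' - Q = (1%:M - Q) - (1%:M - Q') by rewrite opprB [RHS]addrC addrA subrK.
  move: (1%:M - P) (1%:M - P') (1%:M - Q) (1%:M - Q') => A A' B B'.
  by rewrite mulmxBl !mulmxBr !mulmxA addrA subrK.
apply: (le_trans (fnormD _ _)); rewrite mulrAC -mulrA mulr2n mulrDl !mul1r.
set d := fnorm (Y - X) / sigma.
have d0 : 0 <= d by rewrite divr_ge0 ?fnorm_ge0 // ltW.
have tPP : \tr P = \tr P' by rewrite tP tP'.
have tQQ : \tr Q = \tr Q' by rewrite tQ tQ'.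
rewrite (mulrC (fnorm Z)); apply: lerD.
  apply: (le_trans (projB_bound _ hP hP' tPP projC_proj_bound)).
  by apply: ler_wpM2l => //; apply: fnorm_projr; exact: orth_projectorC.
apply: (le_trans (fnorm_projl _ (orth_projectorC hP'))).
rewrite -fnormT trmx_mul linearB /= hQ.1 hQ'.1 -(fnormT Z).
exact: (projB_bound _ hQ hQ' tQQ proj_projC_bound).
Qed.

End TwoPoints.

(** If [Y] had smaller rank, its left kernel would meet the row space of [P] in some [K != 0] by
    counting dimensions. Then [sigma |K| <= |K X| = |K (X - Y)| <= |K| |X - Y|], against the assumed
    closeness. *)
Lemma rank_ge_of_close (r : nat) X Y P Q (sigma : R) :
  tangent_frame r X P Q -> \rank X = r ->
  (forall M, sigma * fnorm (M *m P) <= fnorm (M *m X)) ->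
  fnorm (Y - X) < sigma -> (r <= \rank Y)%N.
Proof.
move=> [hP hQ _ _ [PX XQ]] rX sigmaP close; rewrite leqNgt; apply/negP => rY.
have rP : (r <= \rank P)%N by rewrite -rX -PX mxrankM_maxl.
pose K := (kermx Y :&: P)%MS.
have K0 : K != 0.
  rewrite -mxrank_eq0 -lt0n.
  have := mxrank_sum_cap (kermx Y) P; rewrite mxrank_ker -/K => E.
  have := rank_leq_col (kermx Y + P)%MS; have := rank_leq_row Y; move: E rP rY.
  by move=> *; lia.
have KY : K *m Y = 0 by apply/sub_kermxP; exact: capmxSl.
have KP : K *m P = K.
  have /submxP [A ->] : (K <= P)%MS by exact: capmxSr.
  by rewrite -mulmxA hP.2.
have := sigmaP K; rewrite KP -[in leRHS](subr0 (K *m X)) -KY -mulmxBr.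
move=> h; have := le_trans h (fnormM _ _); rewrite mulrC (fnormB_sym X).
by rewrite ler_pM2l ?fnorm_gt0 // leNgt close.
Qed.

End Perturbation.

(** * Optimality of the truncated SVD *)

Section BestApproximation.
Context {R : realType} {n : nat}.
Implicit Types (X W Q : 'M[R]_n).

Lemma hard_threshold_rank (r : nat) W W' : hard_threshold r W W' -> (\rank W' <= r)%N.
Proof.
move=> [U [s [V [hW ->]]]]; apply: (leq_trans (mxrankM_maxl _ _)).
apply: (leq_trans (mxrankM_maxr _ _)).
set d := \row_i _.
have -> : diag_mx d = diag_mx d *m pid_mx r.
  apply/matrixP => j k; rewrite mul_diag_mx !mxE.
  rewrite -[(j == k :> nat)]/(j == k).
  have [_|_] := eqVneq j k; last by rewrite mulr0n mulr0.
  by rewrite /= mulr1n; case: ltnP; rewrite ?mulr1 ?mul0r.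
apply: (leq_trans (mxrankM_maxr _ _)).
have -> : pid_mx r = pid_mx (minn n r) :> 'M[R]_n.
  by apply/matrixP => j k; rewrite !mxE leq_min ltn_ord.
by rewrite rank_pid_mx ?geq_minl ?geq_minr.
Qed.

(** Weights in [[0, 1]] with total [n - r] do best on the [n - r] smallest values. With a threshold
    [c] between the head and the tail of [s], each [(s_i - c) (g_i - [r <= i])] is nonnegative, and
    the terms in [c] sum to zero. *)
Lemma sum_tail_le (r : nat) (s g : 'I_n -> R) :
  (forall i, 0 <= g i <= 1) -> \sum_i g i = n%:R - r%:R -> (r <= n)%N ->
  (forall i, 0 <= s i) -> (forall i j : 'I_n, (i <= j)%N -> s j <= s i) ->
  \sum_(i < n) (if (i < r)%N then 0 else s i) <= \sum_i s i * g i.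
Proof.
move=> g01 gsum rn s0 srt.
have [c c_lo c_hi] : exists2 c, (forall i : 'I_n, (i < r)%N -> c <= s i) &
    (forall i : 'I_n, (r <= i)%N -> s i <= c).
  have [rn'|nr] := ltnP r n.
    by exists (s (Ordinal rn')) => i ir; apply: srt => //=; rewrite ltnW.
  by exists 0 => [i _|i ri]; [exact: s0 | have := ltn_ord i; rewrite ltnNge (leq_trans nr)].
have tail : \sum_(i < n) (if (i < r)%N then 0 else 1 : R) = n%:R - r%:R.
  have -> : \sum_(i < n) (if (i < r)%N then 0 else 1 : R)
          = \sum_(i < n) (1 - (if (i < r)%N then 1 else 0 : R)).
    by apply: eq_bigr => i _; case: ifP; rewrite ?subrr ?subr0.
  rewrite sumrB sumr_const card_ord -big_mkcond /= (big_ord_narrow rn).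
  by rewrite sumr_const card_ord.
rewrite -subr_ge0 -sumrB.
have E0 : \sum_(i < n) c * (g i - (if (i < r)%N then 0 else 1)) = 0.
  by rewrite -mulr_sumr sumrB gsum tail subrr mulr0.
rewrite -[leLHS]E0.
apply: ler_sum => i _; have /andP [g0 g1] := g01 i.
case: ltnP => [/c_lo|/c_hi] h; nra.
Qed.

(* Eckart-Young: projecting [W - X] onto the complement of the row space of [X]
   leaves [sum s_i^2 g_i], where the weights [g_i] in [0, 1] sum to [n - r]. *)
Lemma hard_threshold_best (r : nat) W W' X Q :
  hard_threshold r W W' -> orth_projector Q -> \tr Q = r%:R -> (r <= n)%N ->
  X *m Q = X -> fnorm (W' - W) <= fnorm (W - X).
Proof.
move=> [U [s [V [[[U1 V1 srt WE] s0] W'E]]]] hQ trQ rn XQ.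
have [CT CC] := orth_projectorC hQ.
have VV : V *m V^T = 1%:M by apply: mulmx1C.
pose G := V^T *m (1%:M - Q) *m V.
have GT : G^T = G by rewrite !trmx_mul trmxK CT mulmxA.
have GG : G *m G = G.
  by rewrite /G -!mulmxA (mulmxA V V^T) VV mul1mx (mulmxA (1%:M - Q) (1%:M - Q)) CC.
have trG : \sum_i G i i = n%:R - r%:R.
  rewrite -/(\tr G) mxtrace_mulC mulmxA VV mul1mx linearB /= mxtrace1 trQ //.
have Gs i j : G j i = G i j by rewrite -{1}GT mxE.
(* [G] is [1 - Q] in the basis of right singular vectors. As a symmetric idempotent, its diagonal
   entries are the squared norms of its rows, which forces them into [[0, 1]]. *)
have Gd i : \sum_j G i j ^+ 2 = G i i.
  rewrite -[in RHS]GG mxE; apply: eq_bigr => j _; by rewrite expr2 [G j i]Gs.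
have G01 i : 0 <= G i i <= 1.
  have g0 : 0 <= G i i by rewrite -Gd; apply: sumr_ge0 => j _; exact: sqr_ge0.
  rewrite g0 /=; have : G i i ^+ 2 <= G i i.
    rewrite -[in leRHS]Gd (bigD1 i) //= lerDl.
    by apply: sumr_ge0 => j _; exact: sqr_ge0.
  nra.
apply: (le_trans _ (fnorm_projr (W - X) (orth_projectorC hQ))).
have -> : (W - X) *m (1%:M - Q) = W *m (1%:M - Q).
  by rewrite mulmxBl [X *m _]mulmxBr mulmx1 XQ subrr subr0.
have -> : fnorm (W *m (1%:M - Q)) = fnorm (diag_mx s *m G).
  rewrite {1}WE -!mulmxA fnorm_orthl // /G !mulmxA.
  by rewrite -[in RHS](trmxK V) fnorm_orthr // trmxK.
have -> : W' - W = U *m (diag_mx (\row_i (if (i < r)%N then 0 else - s 0 i))) *m V^T.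
  rewrite W'E WE -mulmxBl -mulmxBr -raddfB /=; congr (_ *m diag_mx _ *m _).
  by apply/rowP => i; rewrite !mxE; case: ifP; rewrite ?subrr ?sub0r.
rewrite fnorm_orthr // fnorm_orthl //; apply: ler_wsqrtr.
have -> : fdot (diag_mx s *m G) (diag_mx s *m G) = \sum_i (s 0 i) ^+ 2 * G i i.
  apply: eq_bigr => i _; rewrite -Gd mulr_sumr; apply: eq_bigr => j _.
  by rewrite mul_diag_mx !mxE -expr2 exprMn.
apply: (le_trans (y := \sum_(i < n) (if (i < r)%N then 0 else s 0 i ^+ 2))); last first.
  apply: sum_tail_le => // [i|i j ij]; first exact: sqr_ge0.
  by rewrite ler_pXn2r ?nnegrE // srt.
apply: ler_sum => i _; rewrite (bigD1 i) //= big1 ?addr0 => [|j ji].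
  by rewrite !mxE eqxx mulr1n; case: ifP; rewrite ?mulr0 // mulrNN expr2.
by rewrite !mxE eq_sym (negPf ji) mulr0n mulr0.
Qed.

End BestApproximation.

(** * Sampling operator and contraction *)

Section OperatorNorm.
Context {R : realType} {n : nat}.

(** The constant [c] only serves to make the supremum one of a bounded set; any crude bound
    suffices. *)
Lemma opnorm_bound (F : 'M[R]_n -> 'M[R]_n) (c : R) :
  (forall a Z, F (a *: Z) = a *: F Z) ->
  0 <= c -> (forall Z, fnorm (F Z) <= c * fnorm Z) ->
  forall Z, fnorm (F Z) <= opnorm F * fnorm Z.
Proof.
move=> FZ c0 Fc Z; have [->|Z0] := eqVneq Z 0.
  have -> : F 0 = 0 by have := FZ 0 0; rewrite !scale0r.
  by rewrite fnorm0 mulr0.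
have z0 := fnorm_gt0 Z0; rewrite -ler_pdivrMr // mulrC.
rewrite -[(fnorm Z)^-1]ger0_norm ?invr_ge0 ?fnorm_ge0 // -fnormZ -FZ.
apply: ub_le_sup.
  exists c => _ [A /= A1 <-]; apply: (le_trans (Fc A)).
  by rewrite -[leRHS]mulr1 ler_wpM2l.
exists ((fnorm Z)^-1 *: Z) => //=.
by rewrite fnormZ ger0_norm ?invr_ge0 ?fnorm_ge0 // mulVf ?gt_eqF.
Qed.

End OperatorNorm.

Section Sampling.
Context {R : realType} {n : nat}.
Variable Omega : seq ('I_n * 'I_n).
Implicit Types (A B Z : 'M[R]_n).

Definition sample_weight : 'M[R]_n := \sum_(w <- Omega) delta_mx w.1 w.2.

Lemma samplingE Z i j : sampling Omega Z i j = Z i j * sample_weight i j.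
Proof. by rewrite mxE. Qed.

Lemma samplingD A B : sampling Omega (A + B) = sampling Omega A + sampling Omega B.
Proof. by apply/matrixP => i j; rewrite [RHS]mxE !samplingE mxE mulrDl. Qed.

Lemma samplingZ a A : sampling Omega (a *: A) = a *: sampling Omega A.
Proof. by apply/matrixP => i j; rewrite [RHS]mxE !samplingE mxE mulrA. Qed.

Lemma samplingN A : sampling Omega (- A) = - sampling Omega A.
Proof. by rewrite -scaleN1r samplingZ scaleN1r. Qed.

Lemma samplingB A B : sampling Omega (A - B) = sampling Omega A - sampling Omega B.
Proof. by rewrite samplingD samplingN. Qed.

Lemma sampling_adj A B : fdot (sampling Omega A) B = fdot A (sampling Omega B).
Proof.
apply: eq_bigr => i _; apply: eq_bigr => j _.
by rewrite !samplingE mulrAC mulrA.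
Qed.

Lemma sample_weightE i j : sample_weight i j = (count (pred1 (i, j)) Omega)%:R.
Proof.
rewrite /sample_weight; elim: Omega => [|[a b] s IH]; first by rewrite big_nil mxE.
rewrite big_cons mxE IH /= natrD; congr (_ + _).
by rewrite mxE /= xpair_eqE (eq_sym i) (eq_sym j).
Qed.

Lemma sample_weight_ge0 i j : 0 <= sample_weight i j.
Proof. by rewrite sample_weightE. Qed.

Lemma sum_sample_weight : \sum_i \sum_j sample_weight i j = (size Omega)%:R.
Proof.
rewrite /sample_weight; elim: Omega => [|[a b] s IH].
  by rewrite big1 // => i _; rewrite big1 // => j _; rewrite big_nil mxE.
rewrite big_cons /= mulrS -IH; under eq_bigr do under eq_bigr do rewrite mxE.
under eq_bigr do rewrite big_split /=.
rewrite big_split /=; congr (_ + _).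
rewrite (bigD1 a) //= [X in _ + X]big1 => [|i /negPf ia]; last first.
  by rewrite big1 // => j _; rewrite mxE ia.
rewrite addr0 (bigD1 b) //= big1 => [|j /negPf jb]; last by rewrite mxE jb andbF.
by rewrite mxE !eqxx addr0.
Qed.

Lemma fnorm_sampling_le (c : R) Z : 0 <= c -> (forall i j, sample_weight i j <= c) ->
  fnorm (sampling Omega Z) <= c * fnorm Z.
Proof.
move=> c0 wc; rewrite -[X in X * _]ger0_norm // -fnormZ; apply: ler_wsqrtr.
apply: ler_sum => i _; apply: ler_sum => j _.
rewrite samplingE mxE -!expr2 !exprMn mulrC ler_wpM2r ?sqr_ge0 //.
by rewrite ler_pXn2r ?nnegrE ?sample_weight_ge0.
Qed.

(** Entrywise [w^2 <= c w]. Passing from the norm to the quadratic form is what later gains the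
    factor [sqrt p]. *)
Lemma fnorm_sampling_sqr_le (c : R) Z : (forall i j, sample_weight i j <= c) ->
  fnorm (sampling Omega Z) ^+ 2 <= c * fdot Z (sampling Omega Z).
Proof.
move=> wc; rewrite fnorm_sqr mulr_sumr; apply: ler_sum => i _.
rewrite mulr_sumr; apply: ler_sum => j _; rewrite !samplingE.
have := wc i j; have := sample_weight_ge0 i j; have := sqr_ge0 (Z i j).
move: (sample_weight i j) (Z i j) => w z z2 w0 wc'.
have := mulr_ge0 (mulr_ge0 z2 w0) (_ : 0 <= c - w); rewrite subr_ge0 => /(_ wc'); nra.
Qed.

Lemma sampling_bounded Z : fnorm (sampling Omega Z) <= (size Omega)%:R * fnorm Z.
Proof.
by apply: fnorm_sampling_le => // i j; rewrite sample_weightE ler_nat count_size.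
Qed.

Lemma sample_weight_le_opnorm i j :
  sample_weight i j <= opnorm (fun Z : 'M[R]_n => sampling Omega Z).
Proof.
have := opnorm_bound (F := fun Z => sampling Omega Z) samplingZ (ler0n _ _) sampling_bounded.
move=> /(_ (delta_mx i j)); rewrite fnorm_delta mulr1; apply: le_trans.
have -> : sampling Omega (delta_mx i j) = sample_weight i j *: delta_mx i j.
  apply/matrixP => a b; rewrite samplingE !mxE.
  by case: andP => [[/eqP -> /eqP ->]|_]; rewrite ?mul1r ?mulr1 ?mul0r ?mulr0.
by rewrite fnormZ fnorm_delta mulr1 ler_norm.
Qed.

End Sampling.

(** * Restricted isometry at a nearby point and the gradient step, with [q = sqrt p] *)

Section Contraction.
Context {R : realType} {n : nat}.
Variables (Omega : seq ('I_n * 'I_n)) (L q eps : R).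
Notation S := (sampling Omega).
Hypotheses (weight_le : forall i j, @sample_weight R n Omega i j <= L).
Hypotheses (L_ge1 : 1 <= L) (q_gt0 : 0 < q) (q_le : q <= L) (eps_gt0 : 0 < eps).

Definition rip_defect P Q (Z : 'M[R]_n) : 'M[R]_n :=
  tproj P Q Z - (q ^+ 2)^-1 *: tproj P Q (S (tproj P Q Z)).

(** For tangent [A] the difference equals [- q^2 <A, rip_defect A>]. The estimate serves both to
    bound [S] on tangent matrices and to control the step size. *)
Lemma rip_quadratic P Q (e : R) A : orth_projector P -> orth_projector Q ->
  (forall Z, fnorm (rip_defect P Q Z) <= e * fnorm Z) -> tproj P Q A = A ->
  `|fdot A (S A) - q ^+ 2 * fnorm A ^+ 2| <= q ^+ 2 * e * fnorm A ^+ 2.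
Proof.
move=> hP hQ rip TA.
have q20 : q ^+ 2 != 0 by rewrite expf_neq0 // gt_eqF.
have -> : fdot A (S A) - q ^+ 2 * fnorm A ^+ 2 = - (q ^+ 2 * fdot A (rip_defect P Q A)).
  rewrite /rip_defect TA fdotBr fdotZr -(tproj_adj A) // TA fnorm_sqr mulrBr.
  by rewrite mulrA mulfV // mul1r opprB.
rewrite normrN normrM ger0_norm ?sqr_ge0 // -mulrA ler_wpM2l ?sqr_ge0 //.
apply: (le_trans (fdot_le_norm _ _)); rewrite expr2 mulrCA ler_wpM2l ?fnorm_ge0 //.
Qed.

Section TwoFrames.
Variables (P Q P' Q' : 'M[R]_n) (d : R).
Hypotheses (hP : orth_projector P) (hQ : orth_projector Q).
Hypotheses (hP' : orth_projector P') (hQ' : orth_projector Q').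
Hypothesis rip : forall Z, fnorm (rip_defect P Q Z) <= eps * fnorm Z.
Hypothesis close : forall Z, fnorm (tproj P' Q' Z - tproj P Q Z) <= d * fnorm Z.
Hypotheses (d_ge0 : 0 <= d) (d_le : d * L * (1 + eps) <= q * eps).

Notation T := (tproj P Q).
Notation T' := (tproj P' Q').
Let kappa := L * q * (1 + eps).
Let kappa' := kappa + d * L.

Let L_ge0 : 0 <= L. Proof. exact: le_trans L_ge1. Qed.
Let L_gt0 : 0 < L. Proof. exact: lt_le_trans L_ge1. Qed.

(** For [A = T Z], [|S A|^2 <= L <A, S A> <= L q^2 (1 + eps) |A|^2]. The factor [sqrt (L (1 + eps))]
    is then rounded up to [L (1 + eps)], using [1 <= L]. *)
Lemma fnorm_sampling_tproj Z : fnorm (S (T Z)) <= kappa * fnorm Z.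
Proof.
have k0 : 0 <= kappa by rewrite !mulr_ge0 ?addr_ge0 // ltW.
apply: (le_trans (y := kappa * fnorm (T Z))); last first.
  by rewrite ler_wpM2l // fnorm_tproj.
set A := T Z; have TA : T A = A by rewrite tprojK.
have := rip_quadratic hP hQ rip TA; rewrite ler_norml => /andP [_ h].
have a0 : 0 <= fnorm A ^+ 2 by exact: sqr_ge0.
rewrite -(ler_pXn2r (n := 2)) ?nnegrE ?(mulr_ge0 k0) ?fnorm_ge0 // exprMn.
apply: (le_trans (fnorm_sampling_sqr_le A weight_le)).
apply: (le_trans (y := L * (q ^+ 2 * (1 + eps) * fnorm A ^+ 2))).
  by rewrite ler_wpM2l //; lra.
have -> : kappa ^+ 2 * fnorm A ^+ 2
  = (L * (1 + eps)) * (L * (q ^+ 2 * (1 + eps) * fnorm A ^+ 2)) by rewrite /kappa; ring.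
have e1 : 0 <= 1 + eps by rewrite addr_ge0 // ltW.
apply: ler_peMl; first by rewrite (mulr_ge0 L_ge0) ?(mulr_ge0 (mulr_ge0 (sqr_ge0 _) e1)).
by rewrite mulrDr mulr1 (le_trans L_ge1) // lerDl mulr_ge0 // ltW.
Qed.

Lemma fnorm_sampling_tproj' Z : fnorm (S (T' Z)) <= kappa' * fnorm Z.
Proof.
have -> : S (T' Z) = S (T Z) + S (T' Z - T Z) by rewrite -samplingD addrC subrK.
apply: (le_trans (fnormD _ _)); rewrite mulrDl lerD ?fnorm_sampling_tproj //.
apply: (le_trans (fnorm_sampling_le _ L_ge0 weight_le)).
by rewrite -mulrA mulrCA ler_wpM2l.
Qed.

Lemma fnorm_tproj_sampling' Z : fnorm (T' (S Z)) <= kappa' * fnorm Z.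
Proof.
have [h|h] := leP (fnorm (T' (S Z))) 0.
  apply: (le_trans h); rewrite mulr_ge0 ?fnorm_ge0 // addr_ge0 ?mulr_ge0 ?addr_ge0 //; exact: ltW.
(* Duality: [T' S] is the adjoint of [S T'], whose bound is already known. *)
rewrite -(ler_pM2l h) -expr2 fnorm_sqr tproj_adj // tprojK // sampling_adj.
rewrite -[X in fdot Z (S X)](tprojK _ hP' hQ') fdotC.
apply: (le_trans (fdot_le _ _)).
rewrite mulrA ler_wpM2r ?fnorm_ge0 // mulrC; exact: fnorm_sampling_tproj'.
Qed.

(** In terms of [y] the closeness hypothesis reads [d L <= q y]. The inequality [y + y^2 <= eps]
    absorbs the second-order terms, so that the constants 4 and 9 come out as whole numbers. *)
Let y := eps / (1 + eps).
Let y_eq : y * (1 + eps) = eps.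
Proof. by rewrite /y divfK // gt_eqF // addr_gt0. Qed.
Let y_gt0 : 0 < y.
Proof. by rewrite divr_gt0 // addr_gt0. Qed.
Let y_le : y + y ^+ 2 <= eps.
Proof.
have /eqP := y_eq; rewrite mulrDr mulr1 => /eqP h.
have : y <= eps by rewrite -h lerDl mulr_ge0 // ltW.
have := y_gt0; have := eps_gt0; nra.
Qed.
Let dL_le : d * L <= q * y.
Proof.
have e0 : 0 < 1 + eps by rewrite addr_gt0.
by rewrite -(ler_pM2r e0) -[leRHS]mulrA y_eq.
Qed.
Let d_le_dL : d <= d * L. Proof. by rewrite ler_peMr. Qed.
Let d_le_y : d <= y.
Proof.
rewrite -(ler_pM2r L_gt0) (le_trans dL_le) // mulrC ler_wpM2l //; exact: ltW.
Qed.
Let dkappa_le : d * kappa <= q ^+ 2 * eps.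
Proof.
have -> : d * kappa = q * (d * L * (1 + eps)) by rewrite /kappa; ring.
by rewrite expr2 -[leRHS]mulrA ler_wpM2l // ltW.
Qed.
Let ddL_le : d * (d * L) <= q ^+ 2 * y ^+ 2.
Proof.
rewrite -exprMn expr2; apply: ler_pM => //; first by rewrite mulr_ge0.
exact: le_trans d_le_dL dL_le.
Qed.

Lemma rip_perturb Z : fnorm (rip_defect P' Q' Z) <= 4 * eps * fnorm Z.
Proof.
have q20 : 0 < q ^+ 2 by rewrite exprn_gt0.
(* Here [T' S T' - T S T = (T' - T) S T + T' S (T' - T)]. The four pieces contribute [eps],
   [d <= y], [d kappa / q^2 <= eps] and [kappa' d / q^2 <= eps + y^2], in total at most [4 eps]. *)
have -> : rip_defect P' Q' Z = rip_defect P Q Z + (T' Z - T Z)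
   - (q ^+ 2)^-1 *: ((T' (S (T Z)) - T (S (T Z))) + T' (S (T' Z - T Z))).
  rewrite /rip_defect samplingB tprojB; move: (q ^+ 2)^-1 => k.
  move: (T' (S (T' Z))) (T' (S (T Z))) (T (S (T Z))) (T' Z) (T Z) => A1 A2 A3 A4 A5.
  by apply/matrixP => i j; rewrite !mxE; ring.
have qi : 0 <= (q ^+ 2)^-1 by rewrite invr_ge0 ltW.
apply: (le_trans (fnormB _ _)); rewrite fnormZ (ger0_norm qi).
set a := fnorm (_ + (T' Z - T Z)); set b := fnorm (_ + _).
have ha : a <= eps * fnorm Z + d * fnorm Z.
  by apply: (le_trans (fnormD _ _)); apply: lerD.
have hb : b <= (d * kappa + kappa' * d) * fnorm Z.
  apply: (le_trans (fnormD _ _)); rewrite mulrDl; apply: lerD.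
    apply: (le_trans (close _)); rewrite -mulrA ler_wpM2l //.
    exact: fnorm_sampling_tproj.
  apply: (le_trans (fnorm_tproj_sampling' _)); rewrite -mulrA ler_wpM2l //.
  by rewrite addr_ge0 ?mulr_ge0 ?addr_ge0 // ltW.
have z0 := fnorm_ge0 Z.
have hb' : (q ^+ 2)^-1 * b <= (2 * eps + y ^+ 2) * fnorm Z.
  rewrite mulrC ler_pdivrMr // (le_trans hb) // mulrAC ler_wpM2r //.
  move: dkappa_le ddL_le; rewrite /kappa'; lra.
apply: (le_trans (lerD ha hb')); rewrite -!mulrDl ler_wpM2r //.
move: d_le_y y_le; lra.
Qed.

Hypothesis eps_lt : eps < 4^-1.

(** [s] stands for the Rayleigh quotient of [S] along the search direction, divided by [p]; thus
    [t = alpha q^2] is its inverse. With [E = Y - X] and [N = X - T' X], the new error is [(1 - t)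
    T' E + t rip_defect E - N + alpha T' S N]. *)
Lemma step_bound (X Y : 'M[R]_n) (alpha s : R) :
  `|s - 1| <= 4 * eps -> alpha * q ^+ 2 * s = 1 -> T' Y = Y ->
  fnorm (X - T' X) <= d / 2 * fnorm (Y - X) ->
  fnorm (Y + alpha *: T' (S (X - Y)) - X)
    <= 9 * eps / (1 - 4 * eps) * fnorm (Y - X).
Proof.
move=> hs hal TY hN; set E := Y - X; set e := fnorm E.
have e0 : 0 <= e by exact: fnorm_ge0.
have q20 : 0 < q ^+ 2 by rewrite exprn_gt0.
pose t := alpha * q ^+ 2; have ts : t * s = 1 by [].
have D0 : 0 < 1 - 4 * eps by move: eps_lt; lra.
pose D := (1 - 4 * eps)^-1; have DD : D * (1 - 4 * eps) = 1 by rewrite mulVf // gt_eqF.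
have Dp : 0 < D by rewrite invr_gt0.
have /andP [s1 s2] : 1 - 4 * eps <= s <= 1 + 4 * eps.
  by move: hs; rewrite ler_norml => /andP[]; lra.
have s0 : 0 < s by lra.
have t0 : 0 < t by rewrite -(pmulr_lgt0 _ s0) ts.
have tD : t <= D.
  by rewrite -(ler_pM2r D0) DD -[leRHS]ts ler_wpM2l // ltW.
have t1 : `|1 - t| <= 4 * eps * D.
  have -> : 1 - t = t * (s - 1) by rewrite mulrBr ts mulr1.
  rewrite normrM (ger0_norm (ltW t0)) mulrC; apply: ler_pM => //; exact: ltW.
pose N := X - T' X.
have EN : E = T' E - N by rewrite /E /N tprojB TY; apply/matrixP => i j; rewrite !mxE; ring.
have -> : Y + alpha *: T' (S (X - Y)) - X
   = (1 - t) *: T' E + t *: rip_defect P' Q' E - N + alpha *: T' (S N).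
  have -> : X - Y = - E by rewrite opprB.
  have SE : T' (S E) = T' (S (T' E)) - T' (S N) by rewrite {1}EN samplingB tprojB.
  rewrite samplingN tprojN SE addrAC -/E {1}EN /rip_defect.
  have <- : t * (q ^+ 2)^-1 = alpha by rewrite /t mulfK ?gt_eqF.
  move: (q ^+ 2)^-1 (T' (S (T' E))) (T' (S N)) (T' E) => k A1 A2 A3.
  by apply/matrixP => i j; rewrite !mxE; ring.
have al0 : 0 <= alpha by rewrite -(pmulr_lge0 _ q20) ltW.
have nT : fnorm (T' E) <= e by exact: fnorm_tproj.
have nF : fnorm (rip_defect P' Q' E) <= 4 * eps * e by exact: rip_perturb.
have nN : fnorm N <= d / 2 * e by [].
have nS : fnorm (T' (S N)) <= kappa' * (d / 2 * e).
  apply: (le_trans (fnorm_tproj_sampling' _)); apply: ler_wpM2l => //.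
  by rewrite addr_ge0 ?mulr_ge0 ?addr_ge0 // ltW.
apply: (le_trans (fnormD _ _)); apply: (le_trans (lerD (fnormB _ _) (lexx _))).
apply: (le_trans (lerD (lerD (fnormD _ _) (lexx _)) (lexx _))).
rewrite !fnormZ (ger0_norm (ltW t0)) (ger0_norm al0).
have h1 : `|1 - t| * fnorm (T' E) <= 4 * eps * D * e by apply: ler_pM; rewrite ?fnorm_ge0.
have h2 : t * fnorm (rip_defect P' Q' E) <= D * (4 * eps * e).
  by apply: ler_pM; rewrite ?fnorm_ge0 // ltW.
have h4 : alpha * fnorm (T' (S N)) <= D * ((eps + y ^+ 2) / 2 * e).
  apply: (le_trans (ler_wpM2l al0 nS)).
  have -> : alpha * (kappa' * (d / 2 * e))
          = t * ((d * kappa + d * (d * L)) / 2 / q ^+ 2 * e).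
    by rewrite /t /kappa'; field; rewrite gt_eqF.
  apply: ler_pM => //; first exact: ltW.
    by rewrite !mulr_ge0 ?invr_ge0 ?addr_ge0 ?mulr_ge0 ?addr_ge0 // ltW.
  rewrite ler_wpM2r // ler_pdivrMr //; move: dkappa_le ddL_le; lra.
apply: (le_trans (lerD (lerD (lerD h1 h2) nN) h4)).
have -> : 9 * eps / (1 - 4 * eps) * e = 9 * eps * D * e by [].
have -> : 4 * eps * D * e + D * (4 * eps * e) + d / 2 * e + D * ((eps + y ^+ 2) / 2 * e)
   = (8 * eps * D + d / 2 + D * ((eps + y ^+ 2) / 2)) * e by ring.
rewrite ler_wpM2r //.
(* With this, the two terms in [N] add up to at most [D (eps + y + y^2) / 2 <= D eps], the ninth
   unit. *)
have : d <= D * y.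
  apply: (le_trans d_le_y); apply: ler_peMl; first exact: ltW.
  by rewrite invf_ge1 //; move: eps_gt0; lra.
have : D * (y + y ^+ 2) <= D * eps by rewrite ler_wpM2l // ltW.
lra.
Qed.

End TwoFrames.
End Contraction.

(** * Tangent frames of rank [r] matrices and the convergence of RGrad *)

Lemma tangent_frame_exists (R : realType) (n r : nat) (Y : 'M[R]_n) : \rank Y = r ->
  exists P Q, tangent_frame r Y P Q /\ forall Z, tangent_proj r Y Z = tproj P Q Z.
Proof.
move=> rY; have [U [s [V hY]]] := svd_exists Y.
have [hP hQ tP tQ [PY YQ TE]] := rank_tangent_proj hY rY.
by do 2!eexists; split; [split|exact: TE].
Qed.

Lemma tangent_frame_sigma_min (R : realType) (n r : nat) (Y : 'M[R]_n) :
  \rank Y = r -> (0 < r)%N ->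
  exists P Q, [/\ tangent_frame r Y P Q, forall Z, tangent_proj r Y Z = tproj P Q Z,
    0 < sigma_min Y, forall M, sigma_min Y * fnorm (M *m P) <= fnorm (M *m Y) &
    forall M, sigma_min Y * fnorm (Q *m M) <= fnorm (Y *m M)].
Proof.
move=> rY r0; have [U [s [V hY]]] := svd_exists Y.
have [hP hQ tP tQ [PY YQ TE]] := rank_tangent_proj hY rY.
have [s0 sP sQ] := sigma_min_bounds hY rY r0.
by do 2!eexists; split; [split|exact: TE|by []|exact: sP|exact: sQ].
Qed.

Theorem theorem2p2 (R : realType) (n r m : nat)
    (hn : (2 <= n)%N) (hr : (1 <= r <= n)%N) (hm : (1 <= m)%N)
    (X X0 : 'M[R]_n) (hX : \rank X = r) (hX0 : \rank X0 = r)
    (Omega : m.-tuple ('I_n * 'I_n))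
    (p : R) (hp : p = m%:R / n%:R ^+ 2)
    (beta : R) (hbeta : 1 < beta)
    (eps0 : R) (heps0 : 0 < eps0 < 4^-1)
    (nu_g : R) (hnu_g : nu_g = 18 * eps0 / (1 - 4 * eps0)) (hnu_g1 : nu_g < 1)
    (hOmega : opnorm (fun Z : 'M[R]_n => sampling Omega Z)
                <= 8 / 3 * beta * ln n%:R)
    (hT : opnorm (fun Z : 'M[R]_n => tangent_proj r X Z
                    - p^-1 *: tangent_proj r X (sampling Omega (tangent_proj r X Z)))
                <= eps0)
    (hinit : fnorm (X0 - X) / sigma_min X
                <= 3 * Num.sqrt p * eps0 / (16 * beta * ln n%:R * (1 + eps0)))
    (Xl : nat -> 'M[R]_n) (hXl : rgrad_iterates r Omega X X0 Xl) :
  forall l : nat, fnorm (Xl l - X) <= nu_g ^+ l * fnorm (X0 - X).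
Proof.
have /andP [r0 rn] := hr; have /andP [e0 e1] := heps0.
set L := 8 / 3 * beta * ln n%:R in hOmega.
have wL i j : sample_weight Omega i j <= L.
  exact: le_trans (sample_weight_le_opnorm _ _ _) hOmega.
have n0 : (0 : R) < n%:R by rewrite ltr0n; case: (n) hn.
have L1 : 1 <= L.
  (* As [m >= 1], some index is sampled, and its multiplicity is at least 1. *)
  pose w := tnth Omega (Ordinal hm); apply: le_trans (wL w.1 w.2).
  rewrite sample_weightE ler1n -has_count; apply/hasP; exists w; first exact: mem_tnth.
  by rewrite /= -surjective_pairing.
have L0 : 0 < L by exact: lt_le_trans L1.
have p0 : 0 < p by rewrite hp divr_gt0 ?exprn_gt0 // ltr0n.
pose q := Num.sqrt p; have q0 : 0 < q by rewrite sqrtr_gt0.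
have pq : q ^+ 2 = p by rewrite sqr_sqrtr // ltW.
have qL : q <= L.
  rewrite -(ler_pXn2r (n := 2)) ?nnegrE ?(ltW q0) ?(ltW L0) // pq.
  apply: (le_trans (y := L)); last by rewrite expr2 ler_peMr // ltW.
  (* [p] is the average multiplicity over all [n^2] entries, hence at most [L], and [L <= L^2]. *)
  rewrite hp ler_pdivrMr ?exprn_gt0 // -{1}(size_tuple Omega) -sum_sample_weight.
  apply: (le_trans (y := \sum_(i < n) \sum_(j < n) L)).
    by apply: ler_sum => i _; apply: ler_sum => j _; exact: wL.
  by rewrite !sumr_const !card_ord expr2 mulrA !mulr_natr.
have [P [Q [fX TX sig0 sigP sigQ]]] := tangent_frame_sigma_min hX r0.
have [hP hQ tP tQ [PX XQ]] := fX.
have rip Z : fnorm (rip_defect Omega q P Q Z) <= eps0 * fnorm Z.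
  pose F := rip_defect Omega q P Q.
  have FE : (fun Z : 'M[R]_n => tangent_proj r X Z
     - p^-1 *: tangent_proj r X (sampling Omega (tangent_proj r X Z))) = F.
    by apply: funext => A; rewrite /F /rip_defect pq !TX.
  have := @opnorm_bound _ _ F (1 + p^-1 * m%:R).
  rewrite -[X in opnorm X]FE => h; apply: le_trans (h _ _ _ Z) _.
  - move=> a A; rewrite /F /rip_defect !tprojZ samplingZ tprojZ [RHS]scalerBr.
    by rewrite !scalerA [a * _]mulrC.
  - by rewrite addr_ge0 // mulr_ge0 // invr_ge0 ltW.
  - move=> A; rewrite /F /rip_defect; apply: (le_trans (fnormB _ _)).
    rewrite mulrDl mul1r lerD ?fnorm_tproj // fnormZ pq.
    have pi0 : 0 <= p^-1 by rewrite invr_ge0 ltW.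
    rewrite ger0_norm // -mulrA ler_wpM2l //.
    apply: (le_trans (fnorm_tproj _ hP hQ)); apply: (le_trans (sampling_bounded _ _)).
    by rewrite size_tuple ler_wpM2l // fnorm_tproj.
  - by rewrite ler_wpM2r ?fnorm_ge0.
pose sigma := sigma_min X.
have d0_le : 2 * (fnorm (X0 - X) / sigma) * L * (1 + eps0) <= q * eps0.
  move: hinit; have -> : 16 * beta * ln n%:R = 6 * L by rewrite /L; field.
  have pos : 0 < 6 * L * (1 + eps0) by rewrite mulr_gt0 ?addr_gt0 // mulr_gt0.
  by rewrite -/q -/sigma ler_pdivlMr //; lra.
have X0_close : fnorm (X0 - X) < sigma.
  rewrite -[ltRHS]mul1r -ltr_pdivrMr // ltNge; apply/negP => x1; move: d0_le.
  set x := fnorm _ / _ in x1 *; have Le : 0 < L * (1 + eps0) by rewrite mulr_gt0 // addr_gt0.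
  have := ler_wpM2r (ltW Le) x1; have := ler_wpM2r (ltW e0) qL; have := mulr_gt0 L0 e0; lra.
have nu0 : 0 <= nu_g.
  rewrite hnu_g divr_ge0 ?mulr_ge0 //; lra.
have [Xl0 Xstep] := hXl.
(* Rank [r] gives the iterate a tangent frame, and an error not above the initial one lets the
   closeness condition of [X0] carry over. *)
have step l : \rank (Xl l) = r -> fnorm (Xl l - X) <= fnorm (X0 - X) ->
    \rank (Xl l.+1) = r /\ fnorm (Xl l.+1 - X) <= nu_g * fnorm (Xl l - X).
  set Y := Xl l; set Y' := Xl l.+1 => rY eY.
  have [P' [Q' [fY TY]]] := tangent_frame_exists rY.
  have [hP' hQ' _ _ [PY YQ]] := fY.
  set d := 2 * (fnorm (Y - X) / sigma).
  have d0 : 0 <= d by rewrite mulr_ge0 // divr_ge0 ?fnorm_ge0 // ltW.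
  have dle : d * L * (1 + eps0) <= q * eps0.
    have e2 : 0 <= 1 + eps0 by rewrite addr_ge0 // ltW.
    apply: le_trans d0_le; rewrite (ler_wpM2r e2) // (ler_wpM2r (ltW L0)) //.
    by rewrite ler_wpM2l // ler_wpM2r // invr_ge0 ltW.
  have close Z : fnorm (tproj P' Q' Z - tproj P Q Z) <= d * fnorm Z.
    exact: (tprojB_bound fX fY sig0 sigP sigQ).
  have TYY : tproj P' Q' Y = Y.
    by rewrite /tproj mulmxBl mul1mx PY subrr mul0mx subr0.
  have resid : fnorm (X - tproj P' Q' X) <= d / 2 * fnorm (Y - X).
    have -> : d / 2 = fnorm (Y - X) / sigma by rewrite /d; field; rewrite gt_eqF.
    exact: (tproj_residual fX fY sig0 sigP).
  have ripY := rip_perturb wL L1 q0 qL e0 hP hQ hP' hQ' rip close d0 dle.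
  have bound (alpha s : R) : `|s - 1| <= 4 * eps0 -> alpha * q ^+ 2 * s = 1 ->
      fnorm (Y + alpha *: rgrad_dir r Omega X Y - X) <= nu_g / 2 * fnorm (Y - X).
    move=> hs ha; have := step_bound wL L1 q0 qL e0 hP hQ hP' hQ' rip close d0 dle e1 hs ha TYY resid.
    rewrite /rgrad_dir TY; have -> // : nu_g / 2 = 9 * eps0 / (1 - 4 * eps0).
    by rewrite hnu_g; field; rewrite gt_eqF //; lra.
  have e_sigma : nu_g * fnorm (Y - X) < sigma.
    apply: le_lt_trans X0_close; apply: le_trans eY.
    by apply: ler_piMl; [exact: fnorm_ge0 | exact: ltW].
  have := Xstep l; rewrite -/Y -/Y' /rgrad_step; case: ifPn => [/eqP D0|D0].
    move=> Y'Y; split; first by rewrite -rY Y'Y.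
    (* When the direction vanishes, every step size leaves [Y] in place, so the estimate may be read
       off with the ideal values [alpha = p^-1], [s = 1]. *)
    have := bound p^-1 1; rewrite subrr normr0 D0 scaler0 addr0 Y'Y pq mulVf ?gt_eqF // mulr1.
    move=> h; apply: (le_trans (h _ _)) => //; first by rewrite mulr_ge0 // ltW.
    by rewrite ler_wpM2r ?fnorm_ge0 //; lra.
  set D := rgrad_dir r Omega X Y in D0 *; set alpha := rgrad_stepsize _ _ _ _ => hY'.
  have TD : tproj P' Q' D = D by rewrite /D /rgrad_dir TY tprojK.
  have D2 : 0 < fnorm D ^+ 2 by rewrite exprn_gt0 // fnorm_gt0.
  have quad := rip_quadratic q0 hP' hQ' ripY TD.
  pose s := fdot D (sampling Omega D) / (p * fnorm D ^+ 2).
  have hs : `|s - 1| <= 4 * eps0.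
    have pD : 0 < p * fnorm D ^+ 2 by rewrite mulr_gt0.
    have -> : s - 1 = (fdot D (sampling Omega D) - p * fnorm D ^+ 2) / (p * fnorm D ^+ 2).
      by rewrite mulrBl divff ?gt_eqF.
    rewrite normrM normfV (ger0_norm (ltW pD)) ler_pdivrMr //.
    have -> : 4 * eps0 * (p * fnorm D ^+ 2) = p * (4 * eps0) * fnorm D ^+ 2 by ring.
    by move: quad; rewrite pq.
  (* Since [4 * eps0 < 1], the denominator of the step size is nonzero and the quotient is a genuine
     one. *)
  have sn0 : s != 0.
    by apply/eqP => s0; move: hs; rewrite s0 sub0r normrN normr1; lra.
  have ha : alpha * q ^+ 2 * s = 1.
    have fn0 : fdot D (sampling Omega D) != 0.
      by apply: contraNneq sn0; rewrite /s => ->; rewrite mul0r.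
    rewrite pq /alpha /rgrad_stepsize -/D /s; field.
    by rewrite fn0 !gt_eqF ?fnorm_gt0.
  have hW := bound alpha s hs ha; rewrite -/D in hW.
  set W := Y + alpha *: D in hY' hW.
  have best : fnorm (Y' - W) <= fnorm (W - X) := hard_threshold_best hY' hQ tQ rn XQ.
  have contr : fnorm (Y' - X) <= nu_g * fnorm (Y - X).
    have -> : Y' - X = (Y' - W) + (W - X) by rewrite addrA subrK.
    apply: (le_trans (fnormD _ _)); lra.
  split => //; apply/eqP; rewrite eqn_leq (hard_threshold_rank hY') /=.
  exact: rank_ge_of_close fX hX sigP (le_lt_trans contr e_sigma).
move=> l; suff [] : \rank (Xl l) = r /\ fnorm (Xl l - X) <= nu_g ^+ l * fnorm (X0 - X) by [].
elim: l => [|l [rl el]]; first by rewrite Xl0 expr0 mul1r.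
have [|r' e'] := step l rl.
  apply: (le_trans el); apply: ler_piMl; first exact: fnorm_ge0.
  by rewrite exprn_ile1 // ltW.
split => //; apply: (le_trans e'); rewrite exprS -mulrA; exact: ler_wpM2l.
Qed.
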